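(* Let $\pi:(X,T)\to(Y,S)$ be a factor map between two topological dynamical systems, let $\mu\in\mathcal{E}_T(X)$ and let $\mathcal{U}\in\mathcal{C}_X^o$. Then $$\overline{h}^{S}_\mu(T,\mathcal{U}|Y)=\underline{h}^{S}_\mu(T,\mathcal{U}|Y)=h_\mu(T,\mathcal{U}|Y).$$
   Context: A topological dynamical system $(X,T)$ is a compact metrizable space $X$ with a homeomorphism $T:X\to X$. A factor map $\pi:(X,T)\to(Y,S)$ is a continuous surjection $\pi:X\to Y$ with $\pi\circ T=S\circ\pi$. $\mathcal{E}_T(X)$ is the set of $T$-invariant ergodic Borel probability measures on $X$. A cover of $X$ is a finite family of Borel sets with union $X$; a partition is a cover with pairwise disjoint elements; $\mathcal{P}_X$ is the set of partitions of $X$ and $\mathcal{C}_X^o$ the set of (finite) open covers of $X$. For covers, $\alpha\succeq\mathcal{U}$ means that each element of $\alpha$ is contained in some element of $\mathcal{U}$; $\mathcal{U}_0^{n-1}=\bigvee_{i=0}^{n-1}T^{-i}\mathcal{U}$, where $\mathcal{U}\vee\mathcal{V}=\{U\cap V:U\in\mathcal{U},V\in\mathcal{V}\}$. For $\mu\in\mathcal{E}_T(X)$, $\{\mu_x\}$ denotes the canonical system of conditional measures of $\mu$ relative to the measurable partition $\{\pi^{-1}(y):y\in Y\}$ (disintegration of $\mu$ over $\pi$), so $\mu_x(\pi^{-1}\pi x)=1$ and $\mu=\int\mu_x\,d\mu(x)$. For $\alpha\in\mathcal{P}_X$, with $\alpha(x)$ the element of $\alpha$ containing $x$, $$h_\mu(T,\alpha|Y)=\lim_{n\to\infty}\frac1n\int_X-\log\mu_x\big(\alpha_0^{n-1}(x)\big)\,d\mu(x),$$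 and $h_\mu(T,\mathcal{U}|Y)=\inf\{h_\mu(T,\alpha|Y):\alpha\in\mathcal{P}_X,\ \alpha\succeq\mathcal{U}\}$. For a Borel probability measure $m$ on $X$, a cover $\mathcal{U}$ and $0<\rho<1$, $N_m(\mathcal{U},\rho)$ is the minimal number of elements of $\mathcal{U}$ needed to cover a subset of $X$ of $m$-measure at least $1-\rho$. Define $$\overline{h}^{S}_\mu(T,\mathcal{U}|Y)=\lim_{\rho\to0}\limsup_{n\to\infty}\frac1n\int\log N_{\mu_x}(\mathcal{U}_0^{n-1},\rho)\,d\mu(x),\qquad \underline{h}^{S}_\mu(T,\mathcal{U}|Y)=\lim_{\rho\to0}\liminf_{n\to\infty}\frac1n\int\log N_{\mu_x}(\mathcal{U}_0^{n-1},\rho)\,d\mu(x).$$ *)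

(* Defs.v *)
From HB Require Import structures.
From mathcomp Require Import all_boot all_order all_algebra finmap.
From mathcomp Require Import all_classical all_reals all_analysis.
From mathcomp Require Import measurable_realfun.

Set Implicit Arguments.
Unset Strict Implicit.
Unset Printing Implicit Defensive.

Import Order.TTheory GRing.Theory Num.Theory.
Import numFieldNormedType.Exports.

Local Open Scope classical_set_scope.
Local Open Scope ring_scope.

(* [g_sigma_algebraType] is a measurable type only over a pointed carrier,
   hence the join with [Pointed]; a space carrying a probability measure is
   nonempty anyway. *)
#[short(type="pmetricType")]
HB.structure Definition PointedMetric (K : numDomainType) :=
  { M of Metric K M & Pointed M }.

Notation borel X := (g_sigma_algebraType (@open X)).

Section Dynamics.
Context {R : realType}.

Definition homeomorphism (X Y : topologicalType) (f : X -> Y) :=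
  continuous f /\ exists g : Y -> X, [/\ continuous g, cancel f g & cancel g f].

Definition tds (X : topologicalType) (T : X -> X) :=
  compact [set: X] /\ homeomorphism T.

Definition factor_map (X Y : topologicalType) (T : X -> X) (S : Y -> Y)
    (pi : X -> Y) :=
  [/\ continuous pi, range pi = [set: Y] & pi \o T = S \o pi].

Definition invariant_measure (X : ptopologicalType) (T : X -> X)
    (mu : probability (borel X) R) :=
  forall A : set (borel X), measurable A -> mu (T @^-1` A) = mu A.

Definition ergodic (X : ptopologicalType) (T : X -> X)
    (mu : probability (borel X) R) :=
  invariant_measure T mu /\
  forall A : set (borel X), measurable A -> T @^-1` A = A ->
    mu A = 0%E \/ mu A = 1%E.

(* Measurability is with respect to the sub-sigma-algebra of [borel X] pulled
   back from [Y], so [mux x] depends only on the fibre [pi x]. *)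
Definition disintegration (X Y : ptopologicalType) (pi : X -> Y)
    (mu : probability (borel X) R) (mux : X -> probability (borel X) R) :=
  [/\ forall A : set (borel X), measurable A ->
        measurable_fun
          [set: g_sigma_algebra_preimageType (pi : X -> borel Y)]
          (fun x => mux x A),
      {ae mu, forall x, mux x (pi @^-1` [set pi x]) = 1%E} &
      forall A : set (borel X), measurable A ->
        mu A = (\int[mu]_x mux x A)%E].

End Dynamics.

Section Covers.
Context {X : ptopologicalType}.
Implicit Types (T : X -> X) (U V : set (set X)).

Definition borel_cover U :=
  [/\ finite_set U, forall A, U A -> measurable (A : set (borel X)) &
      cover U id = [set: X]].

Definition borel_partition U := borel_cover U /\ trivIset U id.

Definition open_cover U :=
  [/\ finite_set U, forall A, U A -> open A & cover U id = [set: X]].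

Definition refines V U :=
  forall A, V A -> exists2 B, U B & A `<=` B.

Definition cover_join U V : set (set X) :=
  [set W | exists A B, [/\ U A, V B & W = A `&` B]].

Definition cover_preimage (f : X -> X) U : set (set X) :=
  [set f @^-1` A | A in U].

(* [cover_iter T U n] is $U_0^{n-1}$ *)
Definition cover_iter T U (n : nat) : set (set X) :=
  \big[cover_join/[set [set: X]]]_(i < n) cover_preimage (iter i T) U.

End Covers.

Section Entropy.
Context {R : realType} {X : ptopologicalType}.
Variables (T : X -> X) (mu : probability (borel X) R)
  (mux : X -> probability (borel X) R).
Local Open Scope ereal_scope.

Definition partition_entropy (alpha : set (set X)) : \bar R :=
  limn (fun n : nat => (n%:R^-1)%:E *
    \int[mu]_x (- lne (mux x (pblock (cover_iter T alpha n) id x)))).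

Definition cover_entropy (U : set (set X)) : \bar R :=
  ereal_inf [set partition_entropy alpha | alpha in
    [set alpha | borel_partition alpha /\ refines alpha U]].

Definition covering_number (m : probability (borel X) R) (U : set (set X))
    (rho : R) : R :=
  inf [set (#|` F|%fset%:R : R) | F in [set F : {fset (set X)} |
    [set` F] `<=` U /\
    exists A : set (borel X), [/\ measurable A, (1 - rho)%:E <= m A &
      A `<=` cover [set` F] id]]].

Definition average_log_covering (U : set (set X)) (rho : R) (n : nat) :
    \bar R :=
  (n%:R^-1)%:E *
    \int[mu]_x (ln (covering_number (mux x) (cover_iter T U n) rho))%:E.

Definition upper_katok_entropy (U : set (set X)) : \bar R :=
  lim (limn_esup (average_log_covering U rho) @[rho --> (0 : R)^'+]).

Definition lower_katok_entropy (U : set (set X)) : \bar R :=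
  lim (limn_einf (average_log_covering U rho) @[rho --> (0 : R)^'+]).

End Entropy.

(* Main.v *)
Require Import Defs.
From mathcomp Require Import all_boot all_order all_algebra finmap.
From mathcomp Require Import all_classical all_reals all_analysis.
From mathcomp Require Import measurable_realfun.
From mathcomp Require Import lra zify.

(** A predictor assigns to each letter a conditional probability that depends on the
    fibre and on finitely many preceding letters.  The product of its predictions is a
    subprobability on words, so by Gibbs' inequality its expected cost bounds the
    conditional entropy rate from above, and Markov predictors show that the rate is the
    infimum of these costs.

    Upper bound: for a partition finer than the cover, the same comparison together
    with the maximal ergodic inequality for the cost of a nearly optimal predictor shows
    that most words of length n have conditional mass at least exp(- n r) when r exceeds
    the rate; there are at most exp(n r) of them, and they cover most of the fibre.

    Lower bound: fix n and choose in each fibre a minimal family of n-cylinders of the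
    cover.  The backward hitting time of a set of small measure, taken modulo n, is a
    clock with few defects.  Label a point by the letter that its current block, read
    from the minimal family of the fibre where the block starts, shows at the clock
    time.  Predicting each letter from the prefix already seen, the costs telescope over
    a block to the logarithm of the covering number, and averaging over the phase of the
    clock gives the average of this logarithm divided by n.  If there are no sets of
    small positive measure then every entropy rate is 0. *)

Set Implicit Arguments.
Unset Strict Implicit.
Unset Printing Implicit Defensive.

Import Order.TTheory GRing.Theory Num.Theory.
Import numFieldNormedType.Exports.

Local Open Scope classical_set_scope.
Local Open Scope ring_scope.

(** * Finitely valued measurable labels *)

(** The infinite past never enters: a predictor has finite memory and is mixed with a uniform law,
    so its cost is bounded, and a maximal inequality for bounded functions replaces a conditional
    Shannon-McMillan-Breiman theorem. In the lower bound the difficulty is that a label finer than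
    the cover must be right at every point, while the block structure breaks down at some points.
    Each point is therefore labelled by looking back along its orbit by its own clock value: the
    letter found there is legitimate whatever the clock does elsewhere, and a defect only spoils a
    prediction. The cost of a spoiled prediction is bounded in terms of n, the alphabet and the
    mixing weight alone, so the set driving the clock can be chosen afterwards, small enough to make
    the total price of defects negligible. Half of each prefix weight is uniform; this costs ln 2
    per block, hence ln 2 / n in the rate. Points missed by the minimal family have mass at most rho
    and pay the uniform price n ln K, where K is the size of the cover; the resulting error rho ln K
    disappears in the limit rho -> 0. *)

Definition mlabel {d : measure_display} {X : measurableType d} (L : Type)
  (W : X -> L) := forall B : set L, measurable (W @^-1` B).

Section FiniteLabels.
Context {d : measure_display} {X : measurableType d}.

Lemma mlabel_comp (L L' : Type) (W : X -> L) (g : L -> L') :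
  mlabel W -> mlabel (g \o W).
Proof. by move=> mW B; exact: (mW (g @^-1` B)). Qed.

Lemma mlabel_pre (d' : measure_display) (X' : measurableType d') (L : Type)
  (f : X' -> X) (W : X -> L) :
  measurable_fun setT f -> mlabel W -> mlabel (W \o f).
Proof. by move=> mf mW B; rewrite comp_preimage -[_ @^-1` _]setTI; apply: mf. Qed.

Lemma mlabel_countable (L : countType) (W : X -> L) :
  (forall l, measurable (W @^-1` [set l])) -> mlabel W.
Proof.
move=> mW B; have -> : W @^-1` B = \bigcup_(l in B) (W @^-1` [set l]).
  by apply/seteqP; split=> [x Bx|x [l Bl /= Wl]]; [exists (W x)|rewrite /preimage/= Wl].
rewrite bigcup_mkcond; apply: countable_bigcupT_measurable => [|l]; first exact: countableP.
by case: ifP.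
Qed.

Lemma mlabel_bool (A : set X) : measurable A -> mlabel (fun x => `[< A x >]).
Proof.
move=> mA; apply: mlabel_countable => -[].
  rewrite (_ : _ @^-1` _ = A)//.
  by apply/seteqP; split=> x /=; [move/asboolP|move=> ?; exact/asboolP].
rewrite (_ : _ @^-1` _ = ~` A); first exact: measurableC.
by apply/seteqP; split=> x /=; [move/asboolP|move=> ?; exact/asboolP].
Qed.

Lemma mlabel_pair (L L' : countType) (W : X -> L) (W' : X -> L') :
  mlabel W -> mlabel W' -> mlabel (fun x => (W x, W' x)).
Proof.
move=> mW mW'; apply: mlabel_countable => -[l l'].
have -> : (fun x => (W x, W' x)) @^-1` [set (l, l')] =
    W @^-1` [set l] `&` W' @^-1` [set l'].
  by apply/seteqP; split=> x /= [-> ->].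
exact: measurableI.
Qed.

Lemma mlabel_ffun (I : finType) (L : finType) (W : X -> I -> L) :
  (forall i, mlabel (W ^~ i)) -> mlabel (fun x => [ffun i => W x i]).
Proof.
move=> mW; apply: mlabel_countable => f.
have -> : (fun x => [ffun i => W x i]) @^-1` [set f] =
    \bigcap_(i in [set: I]) (W ^~ i @^-1` [set f i]).
  apply/seteqP; split => x /=; first by move=> <- i _ /=; rewrite ffunE.
  by move=> h; apply/ffunP => i; rewrite ffunE; exact: h.
by apply: fin_bigcap_measurable => // i _; exact: mW.
Qed.

Lemma measurable_label (d' dY : measure_display) (X' : measurableType d')
  (Y : measurableType dY) (L : countType)
  (F : L -> X' -> Y) (p : X -> X') (W : X -> L) :
  measurable_fun setT p -> mlabel W -> (forall l, measurable_fun setT (F l)) ->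
  measurable_fun setT (fun x => F (W x) (p x)).
Proof.
move=> mp mW mF _ B mB; rewrite setTI.
have -> : (fun x => F (W x) (p x)) @^-1` B =
    \bigcup_(l in [set: L]) (W @^-1` [set l] `&` (F l \o p) @^-1` B).
  by apply/seteqP; split => [x Bx|x [l _ [/= <-]]//]; exists (W x).
apply: countable_bigcupT_measurable => [|l]; first exact: countableP.
apply: measurableI => //; rewrite -[_ @^-1` _]setTI.
exact: (measurableT_comp (mF l) mp).
Qed.

Lemma measurable_of_label (dY : measure_display)
  (Y : measurableType dY) (L : countType) (F : L -> Y) (W : X -> L) :
  mlabel W -> measurable_fun setT (fun x => F (W x)).
Proof. by move=> mW _ B mB; rewrite setTI; exact: mW (F @^-1` B). Qed.

End FiniteLabels.

(** * Integration against conditional measures *)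

Section Transfer.
Context {d dZ : measure_display} {R : realType} {X : measurableType d}
  {Z : measurableType dZ}.
Variables (P : probability X R) (p : X -> Z) (kappa : Z -> probability X R).
Local Open Scope ereal_scope.
Import HBNNSimple.

(** The abstract form of a disintegration: [kappa] is a regular conditional probability given [p],
    tested on intersections of an event with a union of fibres. *)
Definition conditional := [/\ measurable_fun setT p,
  forall A, measurable A -> measurable_fun setT (fun z => kappa z A) &
  forall A B, measurable A -> measurable B ->
    P (A `&` p @^-1` B) = \int[P]_(x in p @^-1` B) kappa (p x) A].

(** Approximating [g] by simple functions reduces an integral weighted by [u] to integrals of [u]
    over unions of fibres, the only ones that [conditional] speaks of. It serves both sides of
    [transfer1], with an indicator and with a conditional mass as weight. *)
Lemma integral_comp_weight (g : Z -> \bar R) (u : X -> \bar R)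
  (mg : measurable_fun setT g) :
  measurable_fun setT p -> (forall z, 0 <= g z) ->
  measurable_fun setT u -> (forall x, 0 <= u x) -> (forall x, u x \is a fin_num) ->
  \int[P]_x (g (p x) * u x) =
  limn (fun n => \sum_(r \in range (nnsfun_approx measurableT mg n))
    (r%:E * \int[P]_(x in p @^-1` (nnsfun_approx measurableT mg n @^-1` [set r])) u x)).
Proof.
move=> mp g0 mu u0 uf; set h := nnsfun_approx measurableT mg.
have mh n : measurable_fun setT (fun x => (h n (p x))%:E).
  by apply/measurable_EFinP; apply: measurableT_comp mp => //; exact/measurable_funP.
have -> : \int[P]_x (g (p x) * u x) = limn (fun n => \int[P]_x ((h n (p x))%:E * u x)).
  have gE x : g (p x) * u x = limn (fun n => (h n (p x))%:E * u x).
    by apply/esym/cvg_lim => //; apply: cvgeZr => //; exact: cvg_nnsfun_approx.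
  under eq_integral do rewrite gE.
  apply: monotone_convergence => //.
  - by move=> n; exact: emeasurable_funM.
  - by move=> n x _; rewrite mule_ge0// lee_fin.
  - move=> x _ a b ab; rewrite lee_wpmul2r ?lee_fin//.
    exact/lefP/nd_nnsfun_approx.
congr (limn _); apply/funext => n.
have mpre r : measurable (p @^-1` (h n @^-1` [set r])).
  by rewrite -[_ @^-1` _]setTI; apply: mp.
have hE x : h n (p x) = (\sum_(y \in range (h n)) y * \1_(p @^-1` (h n @^-1` [set y])) x)%R.
  by rewrite [LHS]fimfunE; apply: eq_fsbigr => y _; rewrite !indicE.
have rge0 y : y \in range (h n) -> (0 <= y)%R.
  by rewrite inE => -[z _ <-].
have h0 y x : 0 <= (y * \1_(p @^-1` (h n @^-1` [set y])) x)%:E.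
  rewrite lee_fin indicE; case: (boolP (x \in _)); rewrite ?mulr0// mulr1 inE /= => <-.
  by [].
under eq_integral => x _.
  rewrite hE -fsumEFin// ge0_mule_fsuml//; over.
rewrite ge0_integral_fsum//; last 2 first.
- move=> y; apply: emeasurable_funM => //.
  by apply/measurable_EFinP; apply: measurable_funM => //; exact: measurable_indic.
- by move=> y x _; rewrite mule_ge0.
apply: eq_fsbigr => y yr.
rewrite -ge0_integralZl//; last 2 first.
- exact: measurable_funTS.
- by rewrite lee_fin rge0.
rewrite [RHS]integral_mkcond; apply: eq_integral => x _; rewrite /patch indicE.
by case: ifPn; rewrite /= ?mulr1// mulr0 mul0e.
Qed.

Hypothesis condP : conditional.

Lemma transfer1 (A : set X) (g : Z -> \bar R) : measurable A ->
  measurable_fun setT g -> (forall z, 0 <= g z) ->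
  \int[P]_(x in A) g (p x) = \int[P]_x (g (p x) * kappa (p x) A).
Proof.
move=> mA mg g0; have [mp mk kE] := condP.
have mkp : measurable_fun setT (fun x => kappa (p x) A).
  exact: (measurableT_comp (mk _ mA) mp).
rewrite integral_mkcond.
transitivity (\int[P]_x (g (p x) * (\1_A x)%:E)).
  apply: eq_integral => x _; rewrite /patch indicE.
  by case: ifPn; rewrite /= ?mule1// mule0.
rewrite (integral_comp_weight mg)//; first last.
- by apply/measurable_EFinP; exact: measurable_indic.
rewrite (integral_comp_weight mg)//; last first.
- by move=> x; exact: fin_num_measure.
congr (limn _); apply/funext => n; apply: eq_fsbigr => r _; congr (_ * _).
rewrite integral_indic//; last by rewrite -[_ @^-1` _]setTI; apply: mp.
by rewrite -kE//.
Qed.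

(** Averaging over the label inside each fibre: conditionally on [p x], the label has law
    [kappa (p x)]. *)
Lemma transfer (L : finType) (W : X -> L) (g : L -> Z -> \bar R) :
  mlabel W -> (forall l, measurable_fun setT (g l)) -> (forall l z, 0 <= g l z) ->
  \int[P]_x g (W x) (p x) =
  \int[P]_x \sum_(l : L) (g l (p x) * kappa (p x) (W @^-1` [set l])).
Proof.
move=> mW mg g0; have [mp mk kE] := condP.
have mgp l : measurable_fun setT (fun x => g l (p x)).
  exact: (measurableT_comp (mg l) mp).
rewrite ge0_integral_sum//; last 2 first.
- move=> l; apply: emeasurable_funM => //.
  exact: (measurableT_comp (mk _ (mW _)) mp).
- by move=> l x _; rewrite mule_ge0.
under [RHS]eq_bigr do rewrite -transfer1//.
transitivity (\int[P]_x \sum_(l : L) ((g l (p x)) * (\1_(W @^-1` [set l]) x)%:E)).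
  apply: eq_integral => x _; rewrite (bigD1 (W x))//= big1 ?adde0.
    by rewrite indicE mem_set//= mule1.
  move=> l lW; rewrite indicE memNset ?mule0//= => e.
  by rewrite e eqxx in lW.
rewrite ge0_integral_sum//; last 2 first.
- move=> l; apply: emeasurable_funM => //.
  by apply/measurable_EFinP; exact: measurable_indic.
- by move=> l x _; rewrite mule_ge0// lee_fin.
apply: eq_bigr => l _; rewrite [RHS]integral_mkcond.
apply: eq_integral => x _; rewrite /patch indicE.
by case: ifPn; rewrite /= ?mule1// mule0.
Qed.

End Transfer.

(** * Conditional information and Gibbs' inequality *)

Section Gibbs.
Context {d dZ : measure_display} {R : realType} {X : measurableType d}
  {Z : measurableType dZ}.
Variables (P : probability X R) (p : X -> Z) (kappa : Z -> probability X R).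

Definition cprob (L : Type) (W : X -> L) (l : L) (z : Z) : R :=
  fine (kappa z (W @^-1` [set l])).

Definition information (L : Type) (W : X -> L) (x : X) : R :=
  - ln (cprob W (W x) (p x)).

Hypothesis condP : conditional P p kappa.
Variables (L : finType) (W : X -> L).
Hypothesis mW : mlabel W.

Let mp : measurable_fun setT p. Proof. by case: condP. Qed.

Lemma cprobE l z : (cprob W l z)%:E = kappa z (W @^-1` [set l]).
Proof. by rewrite fineK// fin_num_measure. Qed.

Lemma cprob_ge0 l z : 0 <= cprob W l z.
Proof. by rewrite fine_ge0. Qed.

Lemma cprob_le1 l z : cprob W l z <= 1.
Proof. by rewrite -lee_fin cprobE probability_le1. Qed.

Lemma sum_cprob_pred (Q : pred L) z :
  (\sum_(l | Q l) cprob W l z)%:E = kappa z [set x | Q (W x)].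
Proof.
rewrite -sumEFin; under eq_bigr do rewrite cprobE.
transitivity (\int[kappa z]_x (\sum_(l : L | Q l) (\1_(W @^-1` [set l]) x)%:E))%E.
  under [RHS]eq_integral do rewrite -big_filter.
  rewrite ge0_integral_sum//; last first.
  - by move=> l; apply/measurable_EFinP; exact: measurable_indic.
  by rewrite big_filter; apply: eq_bigr => l _; rewrite integral_indic// setIT.
rewrite -[in RHS](setIT [set x | Q (W x)]) -integral_indic//; last exact: (mW [set l | Q l]).
apply: eq_integral => x _; rewrite [in RHS]indicE.
have e l : l != W x -> (\1_(W @^-1` [set l]) x)%:E = 0%E :> \bar R.
  by move=> lW; rewrite indicE memNset//= => e; rewrite e eqxx in lW.
have [QW|QW] := boolP (Q (W x)).
  rewrite (bigD1 (W x))//= big1 ?adde0 => [|l /andP[_ /e]//].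
  by rewrite indicE !mem_set.
rewrite big1 => [|l Ql]; first by rewrite memNset//=; exact/negP.
by apply: e; apply: contraNneq QW => <-.
Qed.

Lemma sum_cprob z : \sum_l cprob W l z = 1.
Proof.
apply: EFin_inj; rewrite (sum_cprob_pred xpredT) -(probability_setT (kappa z)).
by congr (kappa z _); apply/seteqP.
Qed.

Lemma measurable_cprob l : measurable_fun setT (cprob W l).
Proof.
apply: measurableT_comp => //.
by case: condP => _ + _; apply; exact: mW.
Qed.

Lemma measurable_labelR (q : L -> Z -> R) : (forall l, measurable_fun setT (q l)) ->
  measurable_fun setT (fun x => q (W x) (p x)).
Proof. by move=> mq; exact: measurable_label. Qed.

Lemma information_ge0 x : 0 <= information W x.
Proof. by rewrite oppr_ge0 ln_le0// cprob_le1. Qed.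

Lemma measurable_information : measurable_fun setT (information W).
Proof.
apply: measurable_funN.
apply: measurableT_comp; first exact: measurable_ln.
exact/measurable_labelR/measurable_cprob.
Qed.

(** Averaged over its conditional law, the event that the observed label has conditional probability
    0 gets mass 0 from each letter. *)
Lemma cprob_gt0_ae : {ae P, forall x, 0 < cprob W (W x) (p x)}.
Proof.
pose g l z : \bar R := (\1_(cprob W l @^-1` [set (0 : R)]) z)%:E.
have mg l : measurable_fun setT (g l).
  apply/measurable_EFinP/measurable_indic; rewrite -[_ @^-1` _]setTI.
  exact: measurable_cprob.
have g0 l z : (0 <= g l z)%E by rewrite lee_fin.
have : ae_eq P setT (fun x => g (W x) (p x)) (cst 0%E).
  apply/ae_eq_integral_abs => //; first exact: measurable_label.
  under eq_integral do rewrite gee0_abs//.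
  rewrite (transfer condP mW mg g0).
  under eq_integral => x _.
    rewrite big1; last first.
      move=> l _; rewrite /g -cprobE indicE.
      by case: (boolP (_ \in _)); rewrite ?mul0e// inE /= => ->; rewrite mule0.
    over.
  by rewrite integral0.
apply: filterS => x /(_ Logic.I)/=.
rewrite lt_neqAle cprob_ge0 andbT eq_sym /g indicE => -[] /eqP.
by case: (boolP (_ \in _)); rewrite ?oner_eq0// notin_setE /= => /eqP.
Qed.

Section Subprobability.
Variable q : L -> Z -> R.
Hypothesis mq : forall l, measurable_fun setT (q l).
Hypothesis q_ge0 : forall l z, 0 <= q l z.
Hypothesis q_sum : forall z, \sum_l q l z <= 1.

Let ratio l z := (q l z / cprob W l z)%:E.

Let mratio l : measurable_fun setT (ratio l).
Proof.
apply/measurable_EFinP; apply: measurable_funM => //.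
have -> : (fun z => (cprob W l z)^-1) = (fun z => cprob W l z `^ (-1)).
  by apply/funext => z; rewrite powR_inv1// cprob_ge0.
exact: measurableT_comp (measurable_powR _) (measurable_cprob l).
Qed.

Let ratio_ge0 l z : (0 <= ratio l z)%E.
Proof. by rewrite lee_fin divr_ge0// cprob_ge0. Qed.

(** After averaging the label over the fibre the denominator cancels and the sum of [q] remains;
    letters of conditional probability 0 contribute nothing, division by 0 being 0. *)
Lemma gibbs_ratio :
  (\int[P]_x (q (W x) (p x) / cprob W (W x) (p x))%:E <= 1)%E.
Proof.
have := transfer condP mW mratio ratio_ge0; rewrite /ratio => ->.
apply: (@le_trans _ _ (\int[P]_x (cst 1%E x))%E); last first.
  by rewrite integral_cst//= mul1e probability_le1.
apply: ge0_le_integral => //.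
- by move=> x _; apply: sume_ge0 => l _; rewrite mule_ge0//; exact: ratio_ge0.
- apply: emeasurable_sum => l; apply: emeasurable_funM.
    exact: (measurableT_comp (mratio l) mp).
  have [_ mk _] := condP; exact: (measurableT_comp (mk _ (mW [set l])) mp).
- move=> x _; apply: (@le_trans _ _ (\sum_l q l (p x))%:E); last by rewrite lee_fin.
  rewrite -sumEFin; apply: lee_sum => l _.
  rewrite -cprobE -EFinM lee_fin; have [->|c0] := eqVneq (cprob W l (p x)) 0.
    by rewrite mulr0.
  by rewrite divfK.
Qed.

(** Markov's inequality for the ratio of [gibbs_ratio], whose mean is at most 1. *)
Lemma gibbs_tail (t : R) :
  (P [set x | (cprob W (W x) (p x) < expR (- t) * q (W x) (p x))%R]
     <= (expR (- t))%:E)%E.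
Proof.
set A := [set x | _].
have mA : measurable A.
  have -> : A = (fun x => (cprob W (W x) (p x) < expR (- t) * q (W x) (p x))) @^-1` [set true].
    by apply/seteqP; split => x.
  rewrite -[_ @^-1` _]setTI; apply: measurable_fun_ltr => //.
    exact/measurable_labelR/measurable_cprob.
  by apply: measurable_funM => //; exact: measurable_labelR.
have h : ((expR t)%:E * P A <= 1)%E.
  apply: (le_trans _ gibbs_ratio).
  rewrite -(setIT A) -integral_indic// -ge0_integralZl//; last first.
    by apply/measurable_EFinP; exact: measurable_indic.
  apply: ae_ge0_le_integral => //.
  - apply/measurable_EFinP; apply: measurable_funM => //; exact: measurable_indic.
  - by move=> x _; exact: ratio_ge0.
  - exact: measurable_label mp mW mratio.
  - apply: filterS cprob_gt0_ae => x c0 _.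
    rewrite -EFinM lee_fin indicE; case: (boolP (x \in A)) => [|_].
      rewrite inE /A/= => h; rewrite mulr1 ler_pdivlMr//.
      rewrite -(@ler_pM2l _ (expR (- t))) ?expR_gt0// mulrA -expRD addNr expR0 mul1r.
      exact: ltW.
    by rewrite mulr0 divr_ge0// cprob_ge0.
rewrite -(@lee_pmul2l _ (expR t)%:E) ?lte_fin ?expR_gt0//.
by rewrite -[leRHS]EFinM -expRD addrN expR0.
Qed.

Hypothesis q_gt0 : forall l z, 0 < q l z.

Lemma gibbs_ineq :
  (\int[P]_x (information W x)%:E <= \int[P]_x (- ln (q (W x) (p x)))%:E)%E.
Proof.
have q_le1 l z : q l z <= 1.
  by apply: le_trans (q_sum z); rewrite (bigD1 l)//= lerDl sumr_ge0.
have lnq x : (0 <= (- ln (q (W x) (p x)))%:E)%E.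
  by rewrite lee_fin oppr_ge0 ln_le0.
have mlnq : measurable_fun setT (fun x => (- ln (q (W x) (p x)))%:E).
  apply/measurable_EFinP; apply: measurable_funN.
  apply: measurableT_comp; first exact: measurable_ln.
  exact: measurable_labelR.
have minf := measurable_information.
rewrite -(@leeD2rE _ 1%E)//.
apply: (@le_trans _ _ (\int[P]_x (- ln (q (W x) (p x)))%:E
   + \int[P]_x (q (W x) (p x) / cprob W (W x) (p x))%:E)%E); last first.
  by rewrite leeD2l// gibbs_ratio.
rewrite -ge0_integralD//; last 2 first.
- by move=> x _; exact: ratio_ge0.
- exact: measurable_label mp mW mratio.
have -> : (1 = \int[P]_x cst 1 x)%E by rewrite integral_cst//= mul1e probability_setT.
rewrite -ge0_integralD//; last 2 first.
- by move=> x _; rewrite lee_fin information_ge0.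
- exact/measurable_EFinP.
apply: ae_ge0_le_integral => //.
- by move=> x _; rewrite adde_ge0// lee_fin information_ge0.
- by apply: emeasurable_funD => //; exact/measurable_EFinP.
- by move=> x _; rewrite adde_ge0//; exact: ratio_ge0.
- by apply: emeasurable_funD => //; exact: measurable_label mp mW mratio.
- apply: filterS cprob_gt0_ae => x c0 _.
  rewrite -!EFinD lee_fin /information.
  set c := cprob _ _ _ in c0 *; set r := q _ _.
  have r0 : 0 < r by exact: q_gt0.
  have : ln (r / c) <= r / c - 1.
    have := @le_ln1Dx R (r / c - 1); rewrite [1 + _]addrC subrK; apply.
    by rewrite ltrBrDl addrN divr_gt0.
  by rewrite ln_div// ; lra.
Qed.

End Subprobability.

End Gibbs.

(** * The maximal ergodic inequality *)

Section ErgodicUpperBound.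
Context {d : measure_display} {R : realType} {X : measurableType d}.
Variables (P : probability X R) (T : X -> X).

Definition measure_preserving :=
  measurable_fun setT T /\ forall A, measurable A -> P (T @^-1` A) = P A.

Definition ergodic_on :=
  forall A, measurable A -> T @^-1` A = A -> P A = 0%E \/ P A = 1%E.

Hypothesis mpT : measure_preserving.

Let mT : measurable_fun setT T. Proof. by case: mpT. Qed.

Lemma measurable_iter n : measurable_fun setT (iter n T).
Proof.
elim: n => [|n IH]; first exact: measurable_id.
exact: (measurableT_comp mT IH).
Qed.

Lemma integral_preserving (f : X -> \bar R) : measurable_fun setT f ->
  (forall x, 0 <= f x)%E -> (\int[P]_x f (T x) = \int[P]_x f x)%E.
Proof.
move=> mf f0.
transitivity (\int[pushforward P T]_x f x)%E.
  by rewrite ge0_integral_pushforward.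
by apply: eq_measure_integral => A mA _; case: mpT => _; exact.
Qed.

Lemma integral_preserving_iter n (f : X -> \bar R) : measurable_fun setT f ->
  (forall x, 0 <= f x)%E -> (\int[P]_x f (iter n T x) = \int[P]_x f x)%E.
Proof.
move=> mf f0; elim: n => // n IH; rewrite -IH.
under eq_integral do rewrite iterSr.
rewrite (integral_preserving (f := fun x => f (iter n T x)))//.
exact: (measurableT_comp mf (measurable_iter n)).
Qed.

Lemma preserving_iter n A : measurable A -> P (iter n T @^-1` A) = P A.
Proof.
move=> mA; elim: n => // n IH; rewrite -IH.
rewrite -(proj2 mpT (iter n T @^-1` A)).
  by congr (P _); apply/seteqP; split => x; rewrite /preimage/= -iterS iterSr.
by rewrite -[_ @^-1` _]setTI; exact: measurable_iter.
Qed.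

Definition birkhoff_sum (f : X -> R) n x := \sum_(i < n) f (iter i T x).

(** The maximum of the Birkhoff sums of [g] of lengths 0 to [n], in the recursive form on which
    Garsia's argument rests. *)
Fixpoint max_sum (g : X -> R) n x : R :=
  if n is n'.+1 then Num.max 0 (g x + max_sum g n' (T x)) else 0.

Lemma max_sum_ge0 g n x : 0 <= max_sum g n x.
Proof. by case: n => //= n; rewrite le_max lexx. Qed.

Lemma max_sum_le g n x : max_sum g n x <= max_sum g n.+1 x.
Proof.
elim: n x => [|n IH] x; first exact: max_sum_ge0.
rewrite [leLHS]/= [leRHS]/= ge_max !le_max lexx/=.
by rewrite lerD2l IH orbT.
Qed.

Lemma birkhoff_sum_max g n x : birkhoff_sum g n x <= max_sum g n x.
Proof.
elim: n x => [|n IH] x; first by rewrite /birkhoff_sum big_ord0.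
rewrite /= le_max; apply/orP; right; rewrite /birkhoff_sum big_ord_recl/= lerD2l.
apply: le_trans (IH (T x)); rewrite /birkhoff_sum.
by apply: ler_sum => i _; rewrite -iterSr.
Qed.

Lemma measurable_max_sum g n : measurable_fun setT g -> measurable_fun setT (max_sum g n).
Proof.
move=> mg; elim: n => [|n IH] /=; first exact: measurable_cst.
apply: measurable_maxr; first exact: measurable_cst.
by apply: measurable_funD => //; exact: measurableT_comp.
Qed.

Lemma max_sum_bound g n x (C : R) : (forall x, g x <= C) -> 0 <= C ->
  max_sum g n x <= C *+ n.
Proof.
move=> gC C0; elim: n x => [|n IH] x //=.
by rewrite ge_max mulrn_wge0//= mulrS lerD.
Qed.

Lemma max_sum_mono g m n x : (m <= n)%N -> max_sum g m x <= max_sum g n x.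
Proof.
move=> /subnK <-; elim: (n - m)%N => // k IH.
by apply: (le_trans IH); rewrite addSn; exact: max_sum_le.
Qed.

Section Bounded.
Variables (f : X -> R) (B r r' : R).
Hypotheses (mf : measurable_fun setT f) (f_ge0 : forall x, 0 <= f x)
  (f_le : forall x, f x <= B) (r'_ge0 : 0 <= r').

Let g x := f x - r'.
Let mg : measurable_fun setT g.
Proof. by apply: measurable_funB => //; exact: measurable_cst. Qed.

Let B_ge0 : 0 <= B.
Proof. exact: le_trans (f_ge0 point) (f_le point). Qed.

Let C := B + r'.
Let C_ge0 : 0 <= C. Proof. by rewrite addr_ge0. Qed.
Let gC x : - C <= g x <= C.
Proof. by rewrite /g /C; have := f_ge0 x; have := f_le x; have := r'_ge0; have := B_ge0; lra. Qed.

Let low n := [set x | max_sum g n x < C].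

Let mlow n : measurable (low n).
Proof.
rewrite (_ : low n = max_sum g n @^-1` [set x | x < C]) //.
rewrite -[_ @^-1` _]setTI; apply: (measurable_max_sum n mg) => //.
by rewrite (_ : [set x | _] = `]-oo, C[%classic)//; apply/seteqP; split => x; rewrite /= in_itv.
Qed.

(* Garsia's maximal inequality, in the form of an error term supported where the
   partial maxima have not yet exceeded the bound. *)
Lemma garsia n : (r'%:E <= \int[P]_x (f x)%:E + C%:E * P (low n))%E.
Proof.
have mM k : measurable_fun setT (fun x => (max_sum g k x)%:E).
  exact/measurable_EFinP/measurable_max_sum.
have M0 k x : (0 <= (max_sum g k x)%:E)%E by rewrite lee_fin max_sum_ge0.
have mlo : measurable (T @^-1` low n) by rewrite -[_ @^-1` _]setTI; exact: mT.
have mi : measurable_fun setT (fun x => (\1_(T @^-1` low n) x)%:E : \bar R).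
  exact/measurable_EFinP/measurable_indic.
(* If the maximum at [T x] is at least [C], it compensates any value of [g x] and the truncation at
   0 is inactive; otherwise the indicator pays [C], which exceeds [r']. *)
have step x : ((max_sum g n x)%:E + r'%:E <=
    (f x)%:E + C%:E * (\1_(T @^-1` low n) x)%:E + (max_sum g n (T x))%:E)%E.
  rewrite -EFinM -!EFinD lee_fin.
  apply: (@le_trans _ _ (max_sum g n.+1 x + r')); first by rewrite lerD2r max_sum_le.
  have /andP[g1 g2] := gC x.
  have M0' := max_sum_ge0 g n (T x).
  rewrite [max_sum g n.+1 x]/= maxEle indicE; case: (boolP (_ \in _)).
    by rewrite inE /preimage/low/= => h; case: ifP => _; rewrite /g in g1 g2 *; lra.
  rewrite notin_setE /preimage/low/= => /negP; rewrite -leNgt => h.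
  by case: ifPn; rewrite -?ltNge => h'; rewrite /g in g1 g2 h' *; lra.
have : (\int[P]_x ((max_sum g n x)%:E + r'%:E) <= \int[P]_x
    ((f x)%:E + C%:E * (\1_(T @^-1` low n) x)%:E + (max_sum g n (T x))%:E))%E.
  apply: ge0_le_integral => //.
  - by move=> x _; rewrite adde_ge0// lee_fin.
  - exact: emeasurable_funD.
  - apply: emeasurable_funD; last exact: (measurableT_comp (mM n) mT).
    apply: emeasurable_funD; first exact/measurable_EFinP.
    exact: emeasurable_funM.
have mf' := mf.
rewrite ge0_integralD//.
rewrite integral_cst//= probability_setT mule1.
rewrite ge0_integralD//; last 3 first.
- by move=> x _; rewrite adde_ge0// ?mule_ge0// lee_fin.
- by apply: emeasurable_funD; [exact/measurable_EFinP|exact: emeasurable_funM].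
- exact: (measurableT_comp (mM n) mT).
rewrite (integral_preserving (mM n))// ge0_integralD//; last 4 first.
- by move=> x _; rewrite lee_fin.
- exact/measurable_EFinP.
- by move=> x _; rewrite mule_ge0// lee_fin.
- exact: emeasurable_funM.
rewrite ge0_integralZl//.
rewrite [X in (C%:E * X)%E](_ : _ = P (low n)); last first.
  by rewrite integral_indic// setIT; exact: (proj2 mpT).
have Mfin : (\int[P]_x (max_sum g n x)%:E)%E \is a fin_num.
  rewrite ge0_fin_numE ?integral_ge0//.
  apply: (@le_lt_trans _ _ (\int[P]_x (C *+ n)%:E)%E).
    apply: ge0_le_integral => //.
    by move=> x _; rewrite lee_fin max_sum_bound// => y; have /andP[] := gC y.
  by rewrite integral_cst//= probability_setT mule1 ltry.
by rewrite [leLHS]addeC; rewrite leeD2rE.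
Qed.

Hypothesis ergT : ergodic_on.
Hypothesis int_lt : (\int[P]_x (f x)%:E < r'%:E)%E.

Let over k := [set x | exists n, (k%:R : R) < max_sum g n x].

Let mover k : measurable (over k).
Proof.
rewrite (_ : over k = \bigcup_n (max_sum g n @^-1` `]k%:R, +oo[%classic)).
  apply: bigcupT_measurable => n; rewrite -[_ @^-1` _]setTI.
  by apply: (measurable_max_sum n mg).
apply/seteqP; split => x.
  by move=> [n h]; exists n => //=; rewrite in_itv/= h.
by move=> [n _]; rewrite /= in_itv/= andbT => h; exists n.
Qed.

(** The points at which the Birkhoff sums of [g] are unbounded above; boundedness of [g] makes this
    set invariant. *)
Let E := \bigcap_k over k.

Let mE : measurable E.
Proof. exact: bigcapT_measurable. Qed.

Let E_inv : T @^-1` E = E.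
Proof.
have [c cC] : exists c : nat, C <= c%:R.
  by exists (Num.truncn C).+1; apply/ltW/truncnS_gt.
apply/seteqP; split => x Ex k _.
  have [n] := Ex (k + c)%N Logic.I; exists n.+1 => /=.
  rewrite lt_max; apply/orP; right.
  have /andP[g1 g2] := gC x; rewrite natrD in p; lra.
have [[|n]] := Ex (k + c)%N Logic.I; rewrite /= natrD.
  by rewrite ltNge addr_ge0.
rewrite lt_max => /orP[|h]; first by rewrite ltNge addr_ge0.
by exists n; have /andP[g1 g2] := gC x; lra.
Qed.

(** If [E] had full measure, almost every point would leave the sets [low n], the error term of
    [garsia] would tend to 0, and the resulting bound would contradict [int_lt]. *)
Let PE : P E = 0%E.
Proof.
case: (ergT mE E_inv) => // PE1; exfalso.
have dec : nonincreasing_seq low.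
  move=> m n mn; apply/subsetPset => x /=; apply: le_lt_trans.
  exact: max_sum_mono.
have cv : P (low n) @[n --> \oo] --> P (\bigcap_n low n).
  apply: nonincreasing_cvg_mu => //.
  - by rewrite (le_lt_trans (probability_le1 P _))// ltry.
  - exact: bigcapT_measurable.
have P0 : P (\bigcap_n low n) = 0%E.
  have : P (~` E) = 0%E by rewrite probability_setC// PE1 subee.
  apply: subset_measure0 => //; first exact: bigcapT_measurable.
    exact: measurableC.
  move=> x lx Ex; have [c cC] : exists c : nat, C <= c%:R.
    by exists (Num.truncn C).+1; apply/ltW/truncnS_gt.
  have [n h] := Ex c Logic.I; have := lx n Logic.I; rewrite /low/= => h'.
  by have := lt_trans (le_lt_trans cC h) h'; rewrite ltxx.
rewrite P0 in cv.
suff : (r'%:E <= \int[P]_x (f x)%:E)%E by rewrite leNgt int_lt.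
have Ifin : (\int[P]_x (f x)%:E)%E \is a fin_num.
  rewrite ge0_fin_numE ?integral_ge0//; first exact: (lt_trans int_lt (ltry _)).
  by move=> x _; rewrite lee_fin.
have cv' : (\int[P]_x (f x)%:E + C%:E * P (low n))%E @[n --> \oo] -->
    (\int[P]_x (f x)%:E + C%:E * 0)%E.
  apply: cvgeD => //; first by rewrite mule0 fin_num_adde_defl.
    exact: cvg_cst.
  by apply: cvgeZl.
rewrite -[leRHS]adde0 -(mule0 C%:E) -(cvg_lim _ cv')//.
apply: lime_ge; first by apply/cvg_ex; eexists; exact: cv'.
by near=> n; exact: garsia.
Unshelve. all: by end_near. Qed.

(** An excess over [r *+ n] makes the sum of [f - r'] exceed [(r - r') *+ n], hence any given [k]
    once [n] is large; the sets [over k] decrease to the null set [E]. *)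
Lemma birkhoff_sum_small : r' < r ->
  P [set x | r *+ n < birkhoff_sum f n x] @[n --> \oo] --> 0%E.
Proof.
move=> rr'.
have dec : nonincreasing_seq over.
  move=> m n mn; apply/subsetPset => x [k h]; exists k.
  by apply: le_lt_trans h; rewrite ler_nat.
have cv : P (over k) @[k --> \oo] --> 0%E.
  rewrite -PE; apply: nonincreasing_cvg_mu => //.
  by rewrite (le_lt_trans (probability_le1 P _))// ltry.
have mS n : measurable_fun setT (birkhoff_sum f n).
  apply: measurable_sum => i.
  exact: (measurableT_comp mf (measurable_iter i)).
have mbad n : measurable [set x | r *+ n < birkhoff_sum f n x].
  rewrite (_ : [set x | _] = birkhoff_sum f n @^-1` `]r *+ n, +oo[%classic).
    by rewrite -[_ @^-1` _]setTI; exact: mS.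
  by apply/seteqP; split => x; rewrite /= in_itv/= andbT.
have incl k n : k%:R <= (r - r') *+ n ->
    [set x | r *+ n < birkhoff_sum f n x] `<=` over k.
  move=> kn x /= h; exists n; apply: lt_le_trans (birkhoff_sum_max g n x).
  have -> : birkhoff_sum g n x = birkhoff_sum f n x - r' *+ n.
    rewrite /birkhoff_sum sumrB; congr (_ - _).
    by rewrite sumr_const card_ord.
  by apply: (le_lt_trans kn); rewrite mulrnBl ltrD2r.
apply/fine_cvgP; split.
  by near=> n; exact: fin_num_measure.
apply/cvgrPdist_lt => e e0.
have /fine_cvgP[_ /cvgrPdist_lt/(_ _ e0)[k _ /(_ k (leqnn k))]] := cv.
rewrite /= sub0r normrN ger0_norm ?fine_ge0// => hk.
have [N hN] : exists N : nat, k%:R <= (r - r') *+ N.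
  exists (Num.truncn (k%:R / (r - r'))).+1.
  rewrite -[leRHS]mulr_natr -ler_pdivrMl ?subr_gt0// mulrC.
  exact/ltW/truncnS_gt.
exists N => // n /= Nn; rewrite sub0r normrN ger0_norm ?fine_ge0//.
apply: le_lt_trans hk; apply: fine_le; rewrite ?fin_num_measure//.
apply: le_measure; rewrite ?inE//; apply: incl; apply: (le_trans hN).
by rewrite ler_wpMn2l// subr_ge0 ltW.
Unshelve. all: by end_near. Qed.

End Bounded.

Lemma ergodic_upper (f : X -> R) (B r : R) : ergodic_on ->
  measurable_fun setT f -> (forall x, 0 <= f x) -> (forall x, f x <= B) ->
  (\int[P]_x (f x)%:E < r%:E)%E ->
  P [set x | r *+ n < birkhoff_sum f n x] @[n --> \oo] --> 0%E.
Proof.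
move=> erg mf f0 fB fr.
have I0 : (0 <= \int[P]_x (f x)%:E)%E by apply: integral_ge0 => x _; rewrite lee_fin.
have Ifin : (\int[P]_x (f x)%:E)%E \is a fin_num.
  by rewrite ge0_fin_numE//; exact: (lt_trans fr (ltry _)).
set a := (fine (\int[P]_x (f x)%:E)%E).
have aE : (\int[P]_x (f x)%:E)%E = a%:E by rewrite fineK.
have a0 : 0 <= a by rewrite fine_ge0.
rewrite aE lte_fin in fr.
apply: (@birkhoff_sum_small f B r ((a + r) / 2)) => //; last by lra.
  by rewrite divr_ge0// addr_ge0// (le_trans a0)// ltW.
by rewrite aE lte_fin; lra.
Qed.

End ErgodicUpperBound.

(** * Predictors and conditional block entropy *)

Lemma big_tuple_rcons (R : nmodType) (L : finType) n (F : seq L -> R) :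
  \sum_(t : n.+1.-tuple L) F t = \sum_(t : n.-tuple L) \sum_(a : L) F (rcons t a).
Proof.
rewrite pair_big/=.
rewrite (reindex (fun u : n.-tuple L * L => [tuple of rcons u.1 u.2]))//=.
apply: onW_bij; apply: inj_card_bij.
  by move=> [t a] [t' a'] /(congr1 val)/= /rcons_inj [/val_inj -> ->].
by rewrite card_prod !card_tuple expnSr.
Qed.

Section Words.
Context {d : measure_display} {X : measurableType d} (T : X -> X).
Variables (L : Type) (W : X -> L).

Definition wseq n x : seq L := mkseq (fun i => W (iter i T x)) n.

Lemma size_wseq n x : size (wseq n x) = n.
Proof. by rewrite size_mkseq. Qed.

Definition word n x : n.-tuple L := Tuple (introT eqP (size_wseq n x)).

Lemma wseqS n x : wseq n.+1 x = rcons (wseq n x) (W (iter n T x)).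
Proof. by rewrite /wseq /mkseq -addn1 iotaD map_cat/= cats1. Qed.

Lemma wseqD m n x : wseq (m + n) x = wseq m x ++ wseq n (iter m T x).
Proof.
rewrite /wseq /mkseq iotaD map_cat; congr (_ ++ _).
rewrite add0n -[X in iota X]addn0 iotaDl -map_comp; apply: eq_map => i /=.
by rewrite addnC iterD.
Qed.

Lemma take_wseq m n x : (m <= n)%N -> take m (wseq n x) = wseq m x.
Proof. by move=> /subnKC <-; rewrite wseqD take_size_cat// size_wseq. Qed.

Lemma drop_wseq k n x : drop k (wseq (k + n) x) = wseq n (iter k T x).
Proof. by rewrite wseqD drop_size_cat// size_wseq. Qed.

End Words.

Lemma mlabel_word {d : measure_display} {X : measurableType d} (T : X -> X)
  (L : finType) (W : X -> L) n : measurable_fun setT T -> mlabel W ->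
  mlabel (word T W n).
Proof.
move=> mT mW; pose g (f : {ffun 'I_n -> L}) := [tuple f i | i < n].
have -> : word T W n = g \o (fun x => [ffun i : 'I_n => W (iter i T x)]).
  apply/funext => x; apply: eq_from_tnth => i /=.
  rewrite tnth_mktuple ffunE (tnth_nth (W x))/= nth_mkseq//.
apply: mlabel_comp; apply: mlabel_ffun => i.
apply: (mlabel_pre _ mW); elim: (i : nat) => [|k IH] /=.
  exact: measurable_id.
exact: measurableT_comp.
Qed.

Section Prediction.
Context {d dZ : measure_display} {R : realType} {X : measurableType d}
  {Z : measurableType dZ}.
Variables (P : probability X R) (p : X -> Z) (kappa : Z -> probability X R).
Variables (T : X -> X) (T' : Z -> Z).

Definition factor_setting := [/\ conditional P p kappa, measure_preserving P T,
  measurable_fun setT T' & forall x, p (T x) = T' (p x)].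

Hypothesis setting : factor_setting.
Variables (L : finType) (W : X -> L).
Hypothesis mW : mlabel W.

Let condP : conditional P p kappa. Proof. by case: setting. Qed.
Let mpT : measure_preserving P T. Proof. by case: setting. Qed.
Let mT : measurable_fun setT T. Proof. by case: mpT. Qed.
Let mT' : measurable_fun setT T'. Proof. by case: setting. Qed.
Let mp : measurable_fun setT p. Proof. by case: condP. Qed.
Let mword n : mlabel (word T W n). Proof. exact: mlabel_word. Qed.

Lemma factor_iter n x : p (iter n T x) = iter n T' (p x).
Proof. by elim: n => //= n <-; case: setting. Qed.

Definition block_entropy n : \bar R :=
  (\int[P]_x (information p kappa (word T W n) x)%:E)%E.

(* [c z u] is the conditional probability assigned to the last letter of [u], given
   its first [m] letters and the fibre [z] over which the word [u] starts. *)
Definition predictor (m : nat) (c0 : R) (c : Z -> seq L -> R) := [/\ 0 < c0,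
  forall u, measurable_fun setT (c ^~ u),
  forall z u, size u = m.+1 -> c0 <= c z u &
  forall z u, size u = m -> \sum_a c z (rcons u a) <= 1].

(** The predicted letter is the one at time [m], its predecessors are those at times 0 to [m - 1],
    and the fibre is taken at time 0. *)
Definition pcost (m : nat) (c : Z -> seq L -> R) x := - ln (c (p x) (wseq T W m.+1 x)).

Section FixedPredictor.
Variables (m : nat) (c0 : R) (c : Z -> seq L -> R).
Hypothesis predc : predictor m c0 c.

Let c0_gt0 : 0 < c0. Proof. by case: predc. Qed.
Let c_ge z u : size u = m.+1 -> c0 <= c z u.
Proof. by case: predc => _ _ + _; exact. Qed.
Let c_sum z u : size u = m -> \sum_a c z (rcons u a) <= 1.
Proof. by case: predc => _ _ _; exact. Qed.
Let c_le1 z u : size u = m.+1 -> c z u <= 1.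
Proof.
case/lastP: u => // u a; rewrite size_rcons => -[um].
apply: le_trans (c_sum z um); rewrite (bigD1 a)//= lerDl sumr_ge0// => b _.
by apply/ltW/(lt_le_trans c0_gt0)/c_ge; rewrite size_rcons um.
Qed.
Let c_gt0 z u : size u = m.+1 -> 0 < c z u.
Proof. by move=> um; apply/(lt_le_trans c0_gt0)/c_ge. Qed.

Lemma pcost_ge0 x : 0 <= pcost m c x.
Proof. by rewrite oppr_ge0 ln_le0// c_le1 ?size_wseq. Qed.

Lemma pcost_le x : pcost m c x <= - ln c0.
Proof. by rewrite lerN2 ler_ln ?posrE// ?c_ge ?c_gt0 ?size_wseq. Qed.

Lemma measurable_pcost : measurable_fun setT (pcost m c).
Proof.
apply: measurable_funN; apply: measurableT_comp; first exact: measurable_ln.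
pose F (u : m.+1.-tuple L) z := c z u.
have mF u : measurable_fun setT (F u) by have [_ + _ _] := predc; exact.
exact: measurable_label mp (@mword m.+1) mF.
Qed.

Let K : R := #|L|%:R.
Let K_gt0 : 0 < K.
Proof. by rewrite ltr0n; apply/card_gt0P; exists (W point). Qed.

(** The subprobability on words of length [N + m] generated by the predictor: the first [m] letters
    have no complete past and are drawn uniformly, whence the factor [K ^- m]. *)
Let q N (w : seq L) (z : Z) :=
  K ^- m * \prod_(k < N) c (iter k T' z) (take m.+1 (drop k w)).

Let mq N w : measurable_fun setT (q N w).
Proof.
apply: measurable_funM => //; apply: measurable_prod => k _.
have [_ mc _ _] := predc.
apply: (measurableT_comp (mc _)).
elim: (k : nat) => [|j IH] /=; first exact: measurable_id.
exact: measurableT_comp.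
Qed.

Let size_block N (k : 'I_N) (w : (N + m).-tuple L) : size (take m.+1 (drop k w)) = m.+1.
Proof.
rewrite size_takel// size_drop size_tuple; have := ltn_ord k.
by case: N k w => [[]//|N] k w kN; rewrite addSn -addnS addnC -addnBA// leq_addr.
Qed.

Let q_gt0 N (w : (N + m).-tuple L) z : 0 < q N w z.
Proof.
rewrite mulr_gt0 ?invr_gt0 ?exprn_gt0// prodr_gt0// => k _.
by rewrite c_gt0// size_block.
Qed.

Let q_sum N z : \sum_(w : (N + m).-tuple L) q N w z <= 1.
Proof.
elim: N => [|N IH].
  rewrite /q; under eq_bigr do rewrite big_ord0 mulr1.
  by rewrite sumr_const card_tuple -mulr_natl natrX divff// lt0r_neq0// exprn_gt0.
rewrite (@big_tuple_rcons _ _ (N + m) (fun w => q N.+1 w z)).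
apply: le_trans IH; apply: ler_sum => w _.
have qE a : q N.+1 (rcons w a) z = q N w z * c (iter N T' z) (rcons (drop N w) a).
  rewrite /q big_ord_recr/= mulrA; congr (_ * _ * c _ _).
    apply: eq_bigr => k _; congr (c _ _).
    rewrite drop_rcons ?size_tuple; last by rewrite (leq_trans (ltnW (ltn_ord k)))// leq_addr.
    rewrite -cats1 takel_cat// size_drop size_tuple.
    have := ltn_ord k; case: (N) (k : nat) => // M j; rewrite ltnS => jM.
    by rewrite addSn -addnS addnC -addnBA// leq_addr.
  rewrite drop_rcons ?size_tuple ?leq_addr// take_oversize//.
  by rewrite size_rcons size_drop size_tuple addnC addnK.
under eq_bigr do rewrite qE.
rewrite -mulr_sumr -[leRHS]mulr1 ler_wpM2l//; first exact/ltW/q_gt0.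
by rewrite c_sum// size_drop size_tuple addnC addnK.
Qed.

Let lnq N x : - ln (q N (word T W (N + m) x) (p x)) =
  m%:R * ln K + birkhoff_sum T (pcost m c) N x.
Proof.
have prod_gt0 n : (n <= N)%N ->
    0 < \prod_(k < n) c (iter k T' (p x)) (wseq T W m.+1 (iter k T x)).
  by move=> _; rewrite prodr_gt0// => k _; rewrite c_gt0// size_wseq.
have -> : q N (word T W (N + m) x) (p x) = K ^- m *
    \prod_(k < N) c (iter k T' (p x)) (wseq T W m.+1 (iter k T x)).
  congr (_ * _); apply: eq_bigr => k _; congr (c _ _) => /=.
  have kN : (k + m.+1 <= N + m)%N by rewrite addnS -addSn leq_add2r.
  rewrite -(subnKC (ltnW (leq_trans (leq_trans (ltn_ord k) (leq_addr m N)) (leqnn _)))).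
  by rewrite drop_wseq take_wseq// leq_subRL// ltnW// (leq_trans (ltn_ord k))// leq_addr.
rewrite lnM ?posrE ?invr_gt0 ?exprn_gt0 ?prod_gt0//.
rewrite lnV ?posrE ?exprn_gt0// lnXn// opprD opprK mulr_natl; congr (_ + _).
elim: N prod_gt0 => [|N IH] pg; first by rewrite /birkhoff_sum !big_ord0 ln1 oppr0.
rewrite /birkhoff_sum !big_ord_recr/= lnM ?posrE ?pg// ?c_gt0 ?size_wseq//.
by rewrite opprD IH ?/birkhoff_sum ?/pcost ?factor_iter// => n nN; exact/pg/leqW.
Qed.

Lemma birkhoff_pcost_ge0 N x : 0 <= birkhoff_sum T (pcost m c) N x.
Proof. by apply: sumr_ge0 => i _; exact: pcost_ge0. Qed.

(** Gibbs' inequality for [q]; by invariance each of the [N] predicted letters has the same expected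
    cost. *)
Lemma block_entropy_le N :
  (block_entropy (N + m) <=
    (m%:R * ln K)%:E + N%:R%:E * \int[P]_x (pcost m c x)%:E)%E.
Proof.
have h := @gibbs_ineq _ _ R X Z P p kappa condP _ _ (@mword (N + m))
  (fun w z => q N w z) (mq N) (fun w z => ltW (q_gt0 w z)) (q_sum N) (@q_gt0 N).
apply: (le_trans h); rewrite /=.
under eq_integral do rewrite lnq EFinD.
have mc := measurable_pcost.
have lnK : 0 <= ln K by rewrite ln_ge0// ler1n -(ltr0n R).
have mS : measurable_fun setT (fun x => (birkhoff_sum T (pcost m c) N x)%:E).
  apply/measurable_EFinP; apply: measurable_sum => i.
  exact: (measurableT_comp mc (measurable_iter mpT i)).
rewrite ge0_integralD//; last first.
- by move=> x _; rewrite lee_fin birkhoff_pcost_ge0.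
- by move=> x _; rewrite lee_fin mulr_ge0.
rewrite integral_cst//= probability_setT mule1 leeD2l//.
under eq_integral do rewrite /birkhoff_sum -sumEFin.
rewrite ge0_integral_sum//; last first.
- by move=> i x _; rewrite lee_fin pcost_ge0.
- by move=> i; apply/measurable_EFinP; exact: (measurableT_comp mc (measurable_iter mpT i)).
under eq_bigr => i _.
  rewrite (integral_preserving_iter mpT i (f := fun x => (pcost m c x)%:E)); last first.
  - by move=> x; rewrite lee_fin pcost_ge0.
  - exact/measurable_EFinP.
  over.
set a := (\int[P]_x _)%E; clear h mS.
elim: N => [|N IH]; first by rewrite big_ord0 mul0e.
rewrite big_ord_recr/= -addn1 natrD EFinD ge0_muleDl ?lee_fin// mul1e.
by rewrite leeD2r.
Qed.

Lemma word_tail N (t : R) :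
  (P [set x | (cprob kappa (word T W (N + m)) (word T W (N + m) x) (p x) <
      expR (- (t + m%:R * ln K + birkhoff_sum T (pcost m c) N x)))%R]
    <= (expR (- t))%:E)%E.
Proof.
have h := @gibbs_tail _ _ R X Z P p kappa condP _ _ (@mword (N + m))
  (fun w z => q N w z) (mq N) (fun w z => ltW (q_gt0 w z)) (q_sum N) t.
apply: (le_trans _ h); rewrite le_eqVlt; apply/orP; left; apply/eqP; congr (P _).
apply/seteqP; split => x /=; rewrite -addrA opprD expRD -lnq opprK lnK ?posrE//; exact: q_gt0.
Qed.

End FixedPredictor.

End Prediction.

(** * The entropy rate as the infimum of predictor costs *)

Section EntropyRate.
Context {d dZ : measure_display} {R : realType} {X : measurableType d}
  {Z : measurableType dZ}.
Variables (P : probability X R) (p : X -> Z) (kappa : Z -> probability X R).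
Variables (T : X -> X) (T' : Z -> Z).
Hypothesis setting : factor_setting P p kappa T T'.
Variables (L : finType) (W : X -> L).
Hypothesis mW : mlabel W.

Let condP : conditional P p kappa. Proof. by case: setting. Qed.
Let mpT : measure_preserving P T. Proof. by case: setting. Qed.
Let mT : measurable_fun setT T. Proof. by case: mpT. Qed.
Let mword n : mlabel (word T W n). Proof. exact: mlabel_word. Qed.

Let K : R := #|L|%:R.
Let K_ge1 : 1 <= K.
Proof. by rewrite ler1n; apply/card_gt0P; exists (W point). Qed.
Let K_gt0 : 0 < K. Proof. exact: lt_le_trans ltr01 K_ge1. Qed.
Let lnK_ge0 : 0 <= ln K. Proof. exact: ln_ge0. Qed.

Let H := block_entropy P p kappa T W.

Let H_ge0 n : (0 <= H n)%E.
Proof.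
by apply: integral_ge0 => x _; rewrite lee_fin (information_ge0 p kappa (@mword n)).
Qed.

Lemma predictor_uniform : predictor (L := L) 0 K^-1 (fun (z : Z) u => K^-1).
Proof.
split; rewrite ?invr_gt0//.
by move=> z u _; rewrite sumr_const -[_ *+ _]mulr_natr mulVf// gt_eqF.
Qed.

Lemma block_entropy_bound n : (H n <= (n%:R * ln K)%:E)%E.
Proof.
have := block_entropy_le setting mW predictor_uniform n; rewrite addn0 mul0r add0e.
move=> h; apply: (le_trans h); rewrite EFinM lee_wpmul2l ?lee_fin//.
rewrite /pcost integral_cst//= probability_setT mule1.
by rewrite lnV ?opprK// posrE.
Qed.

Lemma block_entropy_fin n : H n \is a fin_num.
Proof. by rewrite ge0_fin_numE//; apply: (le_lt_trans (block_entropy_bound n)); exact: ltry. Qed.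

Lemma cprob_word n (u : n.-tuple L) z :
  cprob kappa (word T W n) u z = cprob kappa (wseq T W n) (val u) z.
Proof.
rewrite /cprob; congr (fine (kappa z _)); apply/seteqP; split => x /=.
  by move=> <-.
by move=> h; apply: val_inj.
Qed.

Lemma measurable_wseq n (u : seq L) : measurable (wseq T W n @^-1` [set u]).
Proof. exact: (mlabel_comp val (@mword n)). Qed.

Lemma sum_cprob_rcons m (u : seq L) z :
  \sum_a cprob kappa (wseq T W m.+1) (rcons u a) z = cprob kappa (wseq T W m) u z.
Proof.
have mm n v : kappa z (wseq T W n @^-1` [set v]) = (cprob kappa (wseq T W n) v z)%:E.
  by rewrite /cprob fineK// fin_num_measure//; exact: measurable_wseq.
apply: EFin_inj; rewrite -sumEFin; under eq_bigr do rewrite -mm.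
rewrite -mm -[in RHS](setIT (wseq T W m @^-1` [set u])) -integral_indic//; last first.
  exact: measurable_wseq.
under eq_bigr => a _.
  rewrite -[X in kappa z X]setIT -integral_indic//; last exact: measurable_wseq.
  over.
rewrite -ge0_integral_sum//; last first.
- by move=> a; apply/measurable_EFinP/measurable_indic; exact: measurable_wseq.
apply: eq_integral => x _; rewrite sumEFin; congr (_%:E).
rewrite (bigD1 (W (iter m T x)))//= big1 ?addr0.
  rewrite !indicE; congr ((nat_of_bool _)%:R); apply/idP/idP; rewrite !inE /= wseqS.
    by move=> /rcons_inj[].
  by move=> ->.
move=> a aW; rewrite indicE memNset// /= wseqS => /rcons_inj[_ e].
by rewrite e eqxx in aW.
Qed.

Let k n u z : R := cprob kappa (wseq T W n) u z.

Let k_ge0 n u z : 0 <= k n u z.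
Proof. exact: fine_ge0. Qed.

(** The conditional law of the next letter given the fibre and [m] letters, mixed with a uniform
    part of weight [e] that bounds the cost. *)
Definition markov_predictor (m : nat) (e : R) (z : Z) (u : seq L) :=
  (1 - e) * (k m.+1 u z / k m (take m u) z) + e / K.

Lemma predictor_markov m e : 0 < e < 1 ->
  predictor m (e / K) (markov_predictor m e).
Proof.
move=> /andP[e0 e1]; split; first by rewrite divr_gt0.
- move=> u; apply: measurable_funD => //; apply: measurable_funM => //.
  have mk n v : measurable_fun setT (k n v).
    have [_ mk _] := condP; have := mk _ (measurable_wseq n v).
    by apply: measurableT_comp.
  apply: measurable_funM => //.
  rewrite (_ : (fun z => _) = fun z => k m (take m u) z `^ (-1)); last first.
    by apply/funext => z; rewrite powR_inv1.
  exact: measurableT_comp (measurable_powR _) (mk _ _).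
- by move=> z u _; rewrite lerDr mulr_ge0 ?divr_ge0// subr_ge0 ltW.
- move=> z u um; rewrite /markov_predictor big_split/= sumr_const -mulr_sumr.
  have -> : (e / K) *+ #|L| = e by rewrite -[_ *+ _]mulr_natr divfK// gt_eqF.
  rewrite -[leRHS](subrK e) lerD2r ler_piMr ?subr_ge0 ?(ltW e1)//.
  under eq_bigr do rewrite -cats1 take_size_cat// cats1.
  rewrite -mulr_suml /k sum_cprob_rcons.
  have [->|c0] := eqVneq (cprob kappa (wseq T W m) u z) 0; first by rewrite mul0r.
  by rewrite mulfV.
Qed.

(** The chain rule: without its uniform part the predictor costs exactly [- ln (1 - e)] plus the
    difference of the informations of the words of lengths [m + 1] and [m]. The term [H m] stands on
    the left to avoid a subtraction in [\bar R]. *)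
Lemma markov_cost m e : 0 < e < 1 ->
  (\int[P]_x (pcost p T W m (markov_predictor m e) x)%:E + H m
    <= (- ln (1 - e))%:E + H m.+1)%E.
Proof.
move=> e01; have pm := predictor_markov m e01; have /andP[e0 e1] := e01.
have mi n : measurable_fun setT (fun x => (information p kappa (word T W n) x)%:E).
  by apply/measurable_EFinP; exact: (measurable_information condP (@mword n)).
have i0 n x : (0 <= (information p kappa (word T W n) x)%:E)%E.
  by rewrite lee_fin; exact: (information_ge0 p kappa (@mword n)).
have mc := measurable_pcost setting mW pm.
have c0 x : (0 <= (pcost p T W m (markov_predictor m e) x)%:E)%E.
  by rewrite lee_fin (pcost_ge0 p T W pm).
have l0 : 0 <= - ln (1 - e) by rewrite oppr_ge0 ln_le0// gerBl ltW.
have -> : ((- ln (1 - e))%:E = \int[P]_x (- ln (1 - e))%:E)%E.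
  by rewrite integral_cst//= probability_setT mule1.
rewrite /H /block_entropy -!ge0_integralD//; last first.
- exact/measurable_EFinP.
apply: ae_ge0_le_integral => //.
- by move=> x _; rewrite adde_ge0.
- by apply: emeasurable_funD => //; exact/measurable_EFinP.
- by move=> x _; rewrite adde_ge0.
- exact: emeasurable_funD.
apply: filterS (cprob_gt0_ae condP (@mword m.+1)) => x + _.
rewrite /information !cprob_word -!EFinD lee_fin /pcost /markov_predictor /=.
rewrite take_wseq// -!/(k _ _ _).
set k1 := k m.+1 _ _; set k0 := k m _ _ => k1_gt0.
have k01 : k1 <= k0.
  rewrite /k0 /k -sum_cprob_rcons (bigD1 (W (iter m T x)))//= -wseqS lerDl.
  by apply: sumr_ge0 => a _; exact: fine_ge0.
have k0_gt0 : 0 < k0 by exact: lt_le_trans k01.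
have : ln ((1 - e) * (k1 / k0)) <= ln ((1 - e) * (k1 / k0) + e / K).
  rewrite ler_ln ?posrE ?lerDl ?divr_ge0 ?(ltW e0) ?(ltW K_gt0)//.
    by rewrite mulr_gt0 ?divr_gt0// subr_gt0.
  by rewrite addr_gt0 ?mulr_gt0 ?divr_gt0// ?subr_gt0 ?invr_gt0.
rewrite lnM ?posrE ?subr_gt0 ?divr_gt0// ln_div ?posrE//; lra.
Qed.

Let hR n : R := fine (H n).
Let HE n : H n = (hR n)%:E. Proof. by rewrite fineK// block_entropy_fin. Qed.

Definition entropy_increment n : R :=
  fine (block_entropy P p kappa T W n.+1) - fine (block_entropy P p kappa T W n).

Lemma markov_cost_le m e : 0 < e < 1 ->
  (\int[P]_x (pcost p T W m (markov_predictor m e) x)%:E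
    <= (- ln (1 - e) + entropy_increment m)%:E)%E.
Proof.
move=> e01; have := markov_cost m e01.
rewrite !HE -EFinD -leeBrDr// -EFinB /entropy_increment.
by rewrite addrA.
Qed.

Let small_e (x : R) : 0 < x -> exists2 e, 0 < e < 1 & - ln (1 - e) <= x.
Proof.
move=> x0; exists (1 - expR (- x)).
  by rewrite subr_gt0 expR_lt1 oppr_lt0 x0/= gtrBl expR_gt0.
by rewrite opprB addrC subrK expRK opprK.
Qed.

Lemma entropy_increment_ge0 m : 0 <= entropy_increment m.
Proof.
apply/ler_addgt0Pr => x /small_e[e e01 ex].
have := markov_cost_le m e01.
have : (0 <= \int[P]_x (pcost p T W m (markov_predictor m e) x)%:E)%E.
  apply: integral_ge0 => y _; rewrite lee_fin.
  exact: (pcost_ge0 p T W (predictor_markov m e01)).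
move=> h1 /(le_trans h1); rewrite lee_fin; lra.
Qed.

(* Each increment bounds the rate from above, through the Markov predictor of that
   order; this replaces subadditivity of the block entropies. *)
Definition entropy_rate : R := inf (range entropy_increment).

Let has_inf_increment : has_inf (range entropy_increment).
Proof.
split; first by exists (entropy_increment 0); exists 0%N.
by exists 0 => _ [m _ <-]; exact: entropy_increment_ge0.
Qed.

Lemma entropy_rate_le m : entropy_rate <= entropy_increment m.
Proof. by apply: inf_lbound; [case: has_inf_increment|exists m]. Qed.

Lemma entropy_rate_ge0 : 0 <= entropy_rate.
Proof.
apply: lb_le_inf; first by case: has_inf_increment.
by move=> _ [m _ <-]; exact: entropy_increment_ge0.
Qed.

Lemma exists_predictor (x : R) : entropy_rate < x ->
  exists m c0 c, predictor m c0 c /\ (\int[P]_x (pcost p T W m c x)%:E < x%:E)%E.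
Proof.
move=> hx; have [_ [m _ <-] hm] := inf_lt (proj1 has_inf_increment) hx.
have [e e01 ee] : exists2 e, 0 < e < 1 & - ln (1 - e) <= (x - entropy_increment m) / 2.
  by apply: small_e; rewrite divr_gt0// subr_gt0.
exists m, (e / K), (markov_predictor m e); split; first exact: predictor_markov.
apply: (le_lt_trans (markov_cost_le m e01)); rewrite lte_fin; lra.
Qed.

Lemma block_entropy_ge n : ((n%:R * entropy_rate)%:E <= H n)%E.
Proof.
rewrite HE lee_fin; elim: n => [|n IH]; first by rewrite mul0r fine_ge0.
have := entropy_rate_le n; rewrite /entropy_increment -!/(hR _) -[n.+1]addn1 natrD.
by rewrite addn1; lra.
Qed.

(** A predictor of mean cost below the midpoint of the rate and [x] bounds the block entropies; the
    cost of its first [m] letters is absorbed by the remaining gap for large [n]. *)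
Lemma block_entropy_eventually (x : R) : entropy_rate < x ->
  \forall n \near \oo, (H n <= (n%:R * x)%:E)%E.
Proof.
move=> hx; have hx' : entropy_rate < (entropy_rate + x) / 2 by lra.
have [m [c0 [c [pc cx]]]] := exists_predictor hx'.
have h N := block_entropy_le setting mW pc N.
set y := (entropy_rate + x) / 2 in hx' cx.
have [M hM] : exists M : nat, m%:R * ln K <= M%:R * (x - y).
  exists (Num.truncn (m%:R * ln K / (x - y))).+1.
  rewrite -ler_pdivrMr; first exact/ltW/truncnS_gt.
  by rewrite /y; lra.
exists (M + m)%N => // n /= Mn.
have mn : (m <= n)%N by apply: leq_trans Mn; exact: leq_addl.
have Mn' : (M <= n)%N by apply: leq_trans Mn; exact: leq_addr.
rewrite -(subnK mn); apply: (le_trans (h _)).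
apply: (@le_trans _ _ ((m%:R * ln K)%:E + (n - m)%:R%:E * y%:E)%E).
  by rewrite leeD2l// lee_wpmul2l ?lee_fin// ltW.
rewrite -EFinM -EFinD lee_fin subnK// natrB//.
have y0 : 0 <= y by rewrite /y; have := entropy_rate_ge0; lra.
have xy : 0 <= x - y by rewrite /y; lra.
have : M%:R * (x - y) <= n%:R * (x - y) by rewrite ler_wpM2r// ler_nat.
have : 0 <= m%:R * y by rewrite mulr_ge0.
rewrite -/K in hM *; lra.
Qed.

Lemma cvg_entropy_rate :
  ((n%:R^-1)%:E * H n)%E @[n --> \oo] --> entropy_rate%:E.
Proof.
have -> : (fun n => (n%:R^-1)%:E * H n)%E = (fun n => (n%:R^-1 * hR n)%:E).
  by apply/funext => n; rewrite HE.
apply/fine_cvgP; split; first by near=> n.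
apply/cvgrPdist_le => e e0.
have he : entropy_rate < entropy_rate + e by rewrite ltrDl.
near=> n; rewrite /=.
have n0 : 0 < n%:R :> R by rewrite ltr0n; near: n; exists 1%N.
have h1 : hR n <= n%:R * (entropy_rate + e).
  by rewrite -lee_fin -HE; near: n; exact: block_entropy_eventually.
have := block_entropy_ge n; rewrite HE lee_fin => h2.
have na : n%:R * (n%:R^-1 * hR n) = hR n by rewrite mulVKf// gt_eqF.
rewrite -na ler_pM2l// in h1; rewrite -na ler_pM2l// in h2.
by rewrite ler_norml; apply/andP; split; lra.
Unshelve. all: by end_near. Qed.

(** A predictor cheaper than the rate would make the block entropies grow more slowly than
    [block_entropy_ge] allows. *)
Lemma entropy_rate_predictor m c0 c : predictor m c0 c ->
  (entropy_rate%:E <= \int[P]_x (pcost p T W m c x)%:E)%E.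
Proof.
move=> pc; set I := (\int[P]_x _)%E.
have I0 : (0 <= I)%E by apply: integral_ge0 => x _; rewrite lee_fin (pcost_ge0 p T W pc).
have [Iy|] := eqVneq I +oo%E; first by rewrite Iy leey.
move=> Iy; have If : I \is a fin_num by rewrite ge0_fin_numE// ltey.
rewrite -(fineK If) lee_fin leNgt; apply/negP => lt.
set y := fine I in lt.
have h N := block_entropy_le setting mW pc N.
have [M hM] : exists M : nat, m%:R * ln K < M%:R * (entropy_rate - y).
  exists (Num.truncn (m%:R * ln K / (entropy_rate - y))).+1.
  by rewrite -ltr_pdivrMr ?subr_gt0// truncnS_gt.
have := le_trans (block_entropy_ge (M + m)) (h M).
rewrite -/I -(fineK If) -EFinM -EFinD lee_fin -/y natrD.
have : 0 <= m%:R * entropy_rate by rewrite mulr_ge0// entropy_rate_ge0.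
rewrite -/K; lra.
Qed.

End EntropyRate.

(** * Fibrewise covering numbers *)

Section InformationUpperBound.
Context {d dZ : measure_display} {R : realType} {X : measurableType d}
  {Z : measurableType dZ}.
Variables (P : probability X R) (p : X -> Z) (kappa : Z -> probability X R).
Variables (T : X -> X) (T' : Z -> Z).
Hypothesis setting : factor_setting P p kappa T T'.
Hypothesis ergT : ergodic_on P T.
Variables (L : finType) (W : X -> L).
Hypothesis mW : mlabel W.

Let condP : conditional P p kappa. Proof. by case: setting. Qed.
Let mpT : measure_preserving P T. Proof. by case: setting. Qed.
Let mT : measurable_fun setT T. Proof. by case: mpT. Qed.
Let mp : measurable_fun setT p. Proof. by case: condP. Qed.
Let mword n : mlabel (word T W n). Proof. exact: mlabel_word. Qed.

Definition small_word (n : nat) (a : R) : set X :=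
  [set x | cprob kappa (word T W n) (word T W n x) (p x) < a].

Lemma measurable_small_word n a : measurable (small_word n a).
Proof.
rewrite (_ : small_word n a =
  (fun x => cprob kappa (word T W n) (word T W n x) (p x)) @^-1` `]-oo, a[%classic).
  rewrite -[_ @^-1` _]setTI.
  apply: (measurable_label mp (@mword n) (measurable_cprob condP (@mword n))) => //.
by apply/seteqP; split => x; rewrite /= in_itv/=.
Qed.

(** A word of small conditional probability is either much less likely than the predictor says,
    which [word_tail] makes rare, or costly for the predictor, which [ergodic_upper] makes rare. *)
Lemma small_word_cvg0 (r : R) : entropy_rate P p kappa T W < r ->
  P (small_word n (expR (- (n%:R * r)))) @[n --> \oo] --> 0%E.
Proof.
move=> hr; have hr1 : entropy_rate P p kappa T W < (entropy_rate P p kappa T W + r) / 2 by lra.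
have [m [c0 [c [pc cx]]]] := exists_predictor setting mW hr1.
set r1 := (_ / 2) in hr1 cx.
have r1r : r1 < r by rewrite /r1; lra.
have hc := ergodic_upper mpT ergT (measurable_pcost setting mW pc)
  (pcost_ge0 p T W pc) (pcost_le p T W pc) cx.
have r_ge0 : 0 <= r.
  by have := entropy_rate_ge0 setting mW; lra.
apply/fine_cvgP; split.
  by near=> n; apply: fin_num_measure; exact: measurable_small_word.
apply/cvgrPdist_lt => e e0.
have e20 : 0 < e / 2 by rewrite divr_gt0.
have /fine_cvgP[_ /cvgrPdist_lt/(_ _ e20)[M1 _ hM1]] := hc.
pose t := - ln (e / 4).
have et : expR (- t) < e / 2 by rewrite /t opprK lnK ?posrE; lra.
(* The constant loss [t + m ln #|L|] is absorbed by the gap between [r1] and [r] over [M2]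
   letters. *)
have [M2 hM2] : exists M : nat, t + m%:R * ln #|L|%:R <= M%:R * (r - r1).
  exists (Num.truncn ((t + m%:R * ln #|L|%:R) / (r - r1))).+1.
  by rewrite -ler_pdivrMr ?subr_gt0//; exact/ltW/truncnS_gt.
exists (maxn M1 M2 + m)%N => // n /= Mn.
have mn : (m <= n)%N by apply: leq_trans Mn; exact: leq_addl.
have : (maxn M1 M2 <= n - m)%N by rewrite leq_subRL// addnC.
rewrite geq_max => /andP[N1 N2].
rewrite sub0r normrN ger0_norm ?fine_ge0//.
have nE := subnK mn; set N := (n - m)%N in N1 N2 nE.
have mS : measurable_fun setT (birkhoff_sum T (pcost p T W m c) N).
  apply: measurable_sum => i.
  exact: (measurableT_comp (measurable_pcost setting mW pc) (measurable_iter mpT i)).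
pose A := [set x | cprob kappa (word T W n) (word T W n x) (p x) <
   expR (- (t + m%:R * ln #|L|%:R + birkhoff_sum T (pcost p T W m c) N x))].
pose B := [set x | r1 *+ N < birkhoff_sum T (pcost p T W m c) N x].
have mB : measurable B.
  rewrite (_ : B = birkhoff_sum T (pcost p T W m c) N @^-1` `]r1 *+ N, +oo[%classic).
    by rewrite -[_ @^-1` _]setTI; exact: mS.
  by apply/seteqP; split => x; rewrite /= in_itv/= andbT.
have mA : measurable A.
  have -> : A = (fun x => (cprob kappa (word T W n) (word T W n x) (p x) <
   expR (- (t + m%:R * ln #|L|%:R + birkhoff_sum T (pcost p T W m c) N x)))) @^-1` [set true].
    by apply/seteqP; split => x.
  rewrite -[_ @^-1` _]setTI; apply: measurable_fun_ltr => //.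
    exact: (measurable_label mp (@mword n) (measurable_cprob condP (@mword n))).
  apply: measurableT_comp; first exact: measurable_expR.
  by apply: measurable_funN; apply: measurable_funD.
have sub : small_word n (expR (- (n%:R * r))) `<=` A `|` B.
  move=> x; rewrite /small_word/= => hx.
  have [hB|hB] := ltrP (r1 *+ N) (birkhoff_sum T (pcost p T W m c) N x).
    by right.
  left; apply: (lt_le_trans hx); rewrite ler_expR lerN2 -nE natrD.
  have : M2%:R * (r - r1) <= N%:R * (r - r1).
    by rewrite ler_wpM2r ?ler_nat// subr_ge0 ltW.
  have : 0 <= m%:R * r by rewrite mulr_ge0.
  move: hB hM2; rewrite -[r1 *+ N]mulr_natl; lra.
have PA : (P A <= (expR (- t))%:E)%E.
  have := word_tail setting mW pc N t; rewrite /A -nE; exact.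
have PB : (P B < (e / 2)%:E)%E.
  have := hM1 N N1; rewrite /= sub0r normrN ger0_norm ?fine_ge0//.
  by rewrite -lte_fin fineK// fin_num_measure.
rewrite -lte_fin fineK; last by rewrite fin_num_measure//; exact: measurable_small_word.
apply: (@le_lt_trans _ _ (P (A `|` B))).
  apply: le_measure; rewrite ?inE//; first exact: measurable_small_word.
  exact: measurableU.
apply: (@le_lt_trans _ _ (P A + P B)%E).
  by apply: measureU2.
have -> : (e%:E = (e / 2)%:E + (e / 2)%:E)%E by rewrite -EFinD -splitr.
apply: lteD => //; apply: (le_lt_trans PA); by rewrite lte_fin.
Unshelve. all: by end_near. Qed.

End InformationUpperBound.

Section MinimalFamily.
Context {d : measure_display} {R : realType} {X : measurableType d}.
Variables (I : finType) (V : I -> set X).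
Hypothesis mV : forall i, measurable (V i).
Hypothesis covV : forall x, exists i, V i x.

Definition covered (G : {set I}) : set X := \bigcup_(i in [set i | i \in G]) V i.

Definition enough (m : probability X R) (rho : R) (G : {set I}) : bool :=
  ((1 - rho)%:E <= m (covered G))%E.

(** The choice is a function of the finite table telling which families are sufficient, so that it
    depends measurably on the measure. *)
Definition smallest_of (b : {ffun {set I} -> bool}) : {set I} :=
  [arg min_(G < finset.setT | b G) #|G|]%N.

Definition min_family (m : probability X R) (rho : R) : {set I} :=
  smallest_of [ffun G => enough m rho G].

Definition ncov (m : probability X R) (rho : R) : nat := #|min_family m rho|.

Lemma measurable_covered G : measurable (covered G).
Proof. by apply: fin_bigcup_measurable. Qed.

Lemma covered_setT : covered finset.setT = setT.
Proof.
apply/seteqP; split => // x _; have [i Vi] := covV x.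
by exists i => //=; rewrite finset.in_setT.
Qed.

Variables (rho : R).
Hypothesis rho01 : 0 < rho < 1.

Lemma min_familyP m : enough m rho (min_family m rho) /\
  forall G, enough m rho G -> (ncov m rho <= #|G|)%N.
Proof.
rewrite /ncov /min_family /smallest_of; case: arg_minnP.
  by rewrite ffunE /enough covered_setT probability_setT lee_fin gerBl; case/andP: rho01 => /ltW.
move=> G; rewrite ffunE => eG minG; split => // G' eG'.
by apply: minG; rewrite ffunE.
Qed.

Lemma ncov_gt0 m : (0 < ncov m rho)%N.
Proof.
have [+ _] := min_familyP m; rewrite /ncov card_gt0; apply: contraL => /eqP ->.
rewrite /enough /covered (_ : [set i | _] = set0); last first.
  by apply/seteqP; split => i //=; rewrite finset.in_set0.
rewrite bigcup_set0 measure0 lee_fin -ltNge subr_gt0.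
by case/andP: rho01.
Qed.

Lemma ncov_le_card m : (ncov m rho <= #|I|)%N.
Proof. exact: max_card. Qed.

Lemma mlabel_min_family (dZ : measure_display) (Z : measurableType dZ)
  (kappa : Z -> probability X R) :
  (forall A, measurable A -> measurable_fun setT (fun z => kappa z A)) ->
  mlabel (fun z => min_family (kappa z) rho).
Proof.
move=> mk; apply: (mlabel_comp smallest_of); apply: mlabel_ffun => G.
have -> : (fun z => enough (kappa z) rho G) =
    (fun z => `[< ((1 - rho)%:E <= kappa z (covered G))%E >]).
  by apply/funext => z; rewrite asboolb.
apply: mlabel_bool.
have := emeasurable_fun_c_infty measurableT (mk _ (measurable_covered G)) (1 - rho)%:E.
by rewrite setTI.
Qed.

End MinimalFamily.

Definition cylinder (X : Type) (T : X -> X) (I : Type) (V : I -> set X) n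
  (w : n.-tuple I) : set X := [set x | forall i : 'I_n, V (tnth w i) (iter i T x)].

Lemma cylinder_cover (X : Type) (T : X -> X) (I : Type) (V : I -> set X) n :
  (forall x, exists i, V i x) ->
  forall x, exists w : n.-tuple I, cylinder T V w x.
Proof.
move=> cov x; have /choice[f hf] := cov.
exists [tuple f (iter i T x) | i < n] => i; rewrite tnth_mktuple; exact: hf.
Qed.

Section Cylinders.
Context {d : measure_display} {X : measurableType d} (T : X -> X).
Variables (I : finType) (V : I -> set X).

Lemma measurable_cylinder n (w : n.-tuple I) : measurable_fun setT T ->
  (forall i, measurable (V i)) -> measurable (cylinder T V w).
Proof.
move=> mT mV.
have -> : cylinder T V w = \bigcap_(i in [set: 'I_n]) (iter i T @^-1` V (tnth w i)).
  by apply/seteqP; split => x h i; [move=> _|]; exact: h.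
apply: fin_bigcap_measurable => // i _; rewrite -[_ @^-1` _]setTI.
have mi : measurable_fun setT (iter i T).
  by elim: (i : nat) => [|k IH] /=; [exact: measurable_id|exact: measurableT_comp].
exact: mi.
Qed.

End Cylinders.

(** * Covering numbers bounded by the entropy rate of a finer label *)

Section KatokUpper.
Context {d dZ : measure_display} {R : realType} {X : measurableType d}
  {Z : measurableType dZ}.
Variables (P : probability X R) (p : X -> Z) (kappa : Z -> probability X R).
Variables (T : X -> X) (T' : Z -> Z).
Hypothesis setting : factor_setting P p kappa T T'.
Hypothesis ergT : ergodic_on P T.
Variables (L : finType) (W : X -> L).
Hypothesis mW : mlabel W.
Variables (I : finType) (V : I -> set X) (g : L -> I).
Hypothesis mV : forall i, measurable (V i).
Hypothesis gV : forall x, V (g (W x)) x.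

Let condP : conditional P p kappa. Proof. by case: setting. Qed.
Let mpT : measure_preserving P T. Proof. by case: setting. Qed.
Let mT : measurable_fun setT T. Proof. by case: mpT. Qed.
Let mp : measurable_fun setT p. Proof. by case: condP. Qed.
Let mword n : mlabel (word T W n). Proof. exact: mlabel_word. Qed.

Variable rho : R.
Hypothesis rho01 : 0 < rho < 1.
Let rho_gt0 : 0 < rho. Proof. by case/andP: rho01. Qed.

Let cyl n (w : n.-tuple I) := cylinder T V w.
Let mcyl n (w : n.-tuple I) : measurable (cyl w).
Proof. exact: measurable_cylinder. Qed.
Let covcyl n x : exists w : n.-tuple I, cyl w x.
Proof. by apply: cylinder_cover => y; exists (g (W y)). Qed.

Definition cyl_ncov n (m : probability X R) := ncov (@cyl n) m rho.

Let k n (u : n.-tuple L) z := cprob kappa (word T W n) u z.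
Let kE n u z : (@k n u z)%:E = kappa z (word T W n @^-1` [set u]).
Proof. exact: (cprobE kappa (@mword n)). Qed.

Definition small_mass n (a : R) (z : Z) : R := \sum_(u : n.-tuple L | k u z < a) k u z.

Let small_mass_ge0 n a z : 0 <= small_mass n a z.
Proof. by apply: sumr_ge0 => u _; exact: fine_ge0. Qed.

(** At most [a^-1] words have mass at least [a]; they carry mass at least [1 - rho], and [g] sends
    each of them to a cylinder of the cover containing its points. *)
Lemma ncov_good n (a : R) z : 0 < a -> small_mass n a z <= rho ->
  (cyl_ncov n (kappa z))%:R <= a^-1.
Proof.
move=> a0 hz.
pose G := [set u : n.-tuple L | a <= k u z]%SET.
pose G' := [set [tuple of map g (u : n.-tuple L)] | u in G]%SET.
have sumG : 1 - rho <= \sum_(u in G) k u z.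
  rewrite lerBlDr -(sum_cprob kappa (@mword n) z) (bigID (fun u => u \in G))/= lerD2l.
  apply: le_trans hz; rewrite le_eqVlt; apply/orP; left; apply/eqP.
  by apply: eq_bigl => u; rewrite !inE -ltNge.
have eG' : enough (@cyl n) (kappa z) rho G'.
  rewrite /enough.
  have sub : [set x | word T W n x \in G] `<=` covered (@cyl n) G'.
    move=> x /= xG; exists [tuple of map g (word T W n x)].
      by apply/imsetP; exists (word T W n x).
    move=> i; rewrite tnth_map (tnth_nth (W x))/= nth_mkseq//; exact: gV.
  apply: (@le_trans _ _ (kappa z [set x | word T W n x \in G])).
    by rewrite -(sum_cprob_pred kappa (@mword n) (fun u => u \in G)) lee_fin.
  apply: le_measure; rewrite ?inE//.
  - exact: (@mword n [set u | u \in G]).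
  - exact: measurable_covered.
have [_ /(_ _ eG') h] := min_familyP (@covcyl n) rho01 (kappa z).
apply: (@le_trans _ _ (#|G'|%:R)); first by rewrite ler_nat.
apply: (@le_trans _ _ (#|G|%:R)); first by rewrite ler_nat leq_imset_card.
rewrite -[leRHS]mul1r ler_pdivlMr//.
rewrite -[leRHS](sum_cprob kappa (@mword n) z) (bigID (fun u => u \in G))/=.
apply: ler_wpDr; first by apply: sumr_ge0 => u _; exact: fine_ge0.
rewrite mulr_natl -sumr_const; apply: ler_sum => u.
by rewrite inE.
Qed.

Let cyl_ncov_gt0 n m : (0 < cyl_ncov n m)%N.
Proof. by apply: ncov_gt0 => //; exact: covcyl. Qed.

Let KI : R := #|I|%:R.
Let KI_ge1 : 1 <= KI.
Proof. by rewrite ler1n; apply/card_gt0P; exists (g (W point)). Qed.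

Lemma ln_cyl_ncov_ge0 n m : 0 <= ln (cyl_ncov n m)%:R :> R.
Proof. by rewrite ln_ge0// ler1n. Qed.

Lemma ln_cyl_ncov_le n m : ln (cyl_ncov n m)%:R <= n%:R * ln KI :> R.
Proof.
rewrite mulr_natl -lnXn ?(lt_le_trans ltr01)// ler_ln ?posrE ?ltr0n//.
  by rewrite -natrX ler_nat; apply: leq_trans (ncov_le_card _ _ _) _; rewrite card_tuple.
by rewrite exprn_gt0// (lt_le_trans ltr01).
Qed.

Lemma measurable_cyl_ncov n :
  measurable_fun setT (fun x => (ln (cyl_ncov n (kappa (p x)))%:R : R)%:E).
Proof.
have [_ mk _] := condP.
have h := mlabel_min_family (@mcyl n) rho mk.
pose F (G : {set n.-tuple I}) : R := ln #|G|%:R.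
apply/measurable_EFinP.
exact: (measurable_of_label F (mlabel_pre mp h)).
Qed.

Lemma integral_small_mass n a :
  (\int[P]_x (small_mass n a (p x))%:E = P (small_word p kappa T W n a))%E.
Proof.
pose q (u : n.-tuple L) z : \bar R := (\1_(k u @^-1` `]-oo, a[%classic) z)%:E.
have mk u : measurable_fun setT (@k n u) by exact: (measurable_cprob condP (@mword n)).
have mq u : measurable_fun setT (q u).
  apply/measurable_EFinP/measurable_indic; rewrite -[_ @^-1` _]setTI; exact: mk.
have q0 u z : (0 <= q u z)%E by rewrite lee_fin.
have qE u z : q u z = (if (k u z < a)%R then 1 else 0)%E.
  rewrite /q indicE; case: ifPn => h; first by rewrite mem_set//= in_itv/=.
  by rewrite memNset//= in_itv/= => h'; rewrite h' in h.
have := transfer condP (@mword n) mq q0.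
have -> : (\int[P]_x q (word T W n x) (p x) = P (small_word p kappa T W n a))%E.
  rewrite -[in RHS](setIT (small_word p kappa T W n a)) -integral_indic//.
  exact: (measurable_small_word setting mW).
move=> ->; apply: eq_integral => x _; rewrite /small_mass -sumEFin big_mkcond/=.
by apply: eq_bigr => u _; rewrite qE -kE; case: ifP => _; rewrite ?mul1e ?mul0e.
Qed.

Lemma katok_upper_bound (r : R) : entropy_rate P p kappa T W < r ->
  \forall n \near \oo,
    (\int[P]_x (ln (cyl_ncov n (kappa (p x)))%:R)%:E <= (n%:R * r)%:E)%E.
Proof.
move=> hr; set h := entropy_rate _ _ _ _ _ in hr.
pose r1 := (h + r) / 2.
have hr1 : h < r1 by rewrite /r1; lra.
have r1r : r1 < r by rewrite /r1; lra.
have h0 : 0 <= h by exact: (entropy_rate_ge0 setting mW).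
have lnK : 0 <= ln KI by exact: ln_ge0.
(* On a fibre where the small words have mass above [rho] only the trivial bound [n ln KI] is
   available; it is at most [n C] times that mass. *)
pose C := ln KI / rho.
have C0 : 0 <= C by rewrite divr_ge0// ltW.
have C10 : 0 < C + 1 by lra.
have e0 : 0 < (r - r1) / (C + 1) by rewrite divr_gt0// subr_gt0.
have /fine_cvgP[_ /cvgrPdist_lt/(_ _ e0) hcv] := small_word_cvg0 setting ergT mW hr1.
near=> n.
have : fine (P (small_word p kappa T W n (expR (- (n%:R * r1))))) < (r - r1) / (C + 1).
  rewrite -[ltLHS]ger0_norm ?fine_ge0// -normrN -sub0r; near: n; exact: hcv.
set a := expR _; set Pa := P _ => hPa.
have PE : Pa = (fine Pa)%:E.
  by rewrite fineK// fin_num_measure//; exact: (measurable_small_word setting mW).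
have Pa0 : 0 <= fine Pa by rewrite fine_ge0 // /Pa measure_ge0.
have nC : 0 <= n%:R * C by rewrite mulr_ge0.
have pw z : ln (cyl_ncov n (kappa z))%:R <= n%:R * r1 + n%:R * C * small_mass n a z.
  have [hz|hz] := lerP (small_mass n a z) rho.
    apply: (@le_trans _ _ (n%:R * r1)); last by rewrite lerDl mulr_ge0.
    rewrite -[leRHS]expRK ler_ln ?posrE ?expR_gt0 ?ltr0n//.
    by have := ncov_good (expR_gt0 _) hz; rewrite -expRN opprK.
  apply: (le_trans (ln_cyl_ncov_le n _)).
  apply: (@le_trans _ _ (n%:R * C * small_mass n a z)); last by rewrite lerDr mulr_ge0//; lra.
  rewrite /C -!mulrA ler_wpM2l// ler_peMr// mulrC ler_pdivlMr// mul1r; exact: ltW.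
have mk u : measurable_fun setT (@k n u) by exact: (measurable_cprob condP (@mword n)).
have msm : measurable_fun setT (fun x => small_mass n a (p x)).
  apply: (measurableT_comp (f := small_mass n a)) => //.
  rewrite (_ : small_mass n a =
    fun z => \sum_(u : n.-tuple L) k u z * \1_(k u @^-1` `]-oo, a[%classic) z).
    apply: measurable_sum => u; apply: measurable_funM => //.
    by apply: measurable_indic; rewrite -[_ @^-1` _]setTI; exact: mk.
  apply/funext => z; rewrite /small_mass big_mkcond/=; apply: eq_bigr => u _.
  rewrite indicE; case: ifPn => hk; first by rewrite mem_set ?mulr1//= in_itv.
  by rewrite memNset ?mulr0//= in_itv/= => h'; rewrite h' in hk.
apply: (@le_trans _ _ (\int[P]_x ((n%:R * r1)%:E + (n%:R * C)%:E * (small_mass n a (p x))%:E))%E).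
  apply: ge0_le_integral => //.
  - by move=> x _; rewrite lee_fin ln_cyl_ncov_ge0.
  - exact: measurable_cyl_ncov.
  - apply: emeasurable_funD => //; apply: emeasurable_funM => //; exact/measurable_EFinP.
  - by move=> x _; rewrite -EFinM -EFinD lee_fin.
rewrite ge0_integralD//; last first.
- by apply: emeasurable_funM => //; exact/measurable_EFinP.
- by move=> x _; rewrite mule_ge0// lee_fin.
- by move=> x _; rewrite lee_fin mulr_ge0//; lra.
rewrite integral_cst//= probability_setT mule1 ge0_integralZl//; last first.
- by move=> x _; rewrite lee_fin.
- exact/measurable_EFinP.
rewrite integral_small_mass -/Pa PE -EFinM -EFinD lee_fin -mulrA -mulrDr ler_wpM2l//.
rewrite ltr_pdivlMr// in hPa.
have : 0 <= fine Pa * 1 by rewrite mulr1.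
lra.
Unshelve. all: by end_near. Qed.

End KatokUpper.

(** * Coding along a clock *)

Section MarkerHeight.
Context {d : measure_display} {R : realType} {X : measurableType d}.
Variables (P : probability X R) (T S : X -> X).
Hypothesis mpT : measure_preserving P T.
Hypothesis ergT : ergodic_on P T.
Hypothesis mS : measurable_fun setT S.
Hypothesis TK : cancel T S.
Hypothesis SK : cancel S T.

Let mT : measurable_fun setT T. Proof. by case: mpT. Qed.

Lemma measurable_iter_inverse k : measurable_fun setT (iter k S).
Proof.
elim: k => [|k IH]; first exact: measurable_id.
exact: (measurableT_comp mS IH).
Qed.

Lemma iterK k : cancel (iter k T) (iter k S).
Proof. by elim: k => // k IH x; rewrite iterSr iterS TK IH. Qed.

Lemma iterVK k : cancel (iter k S) (iter k T).
Proof. by elim: k => // k IH x; rewrite iterSr iterS SK IH. Qed.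

Variable A : set X.
Hypothesis mA : measurable A.
Hypothesis PA_gt0 : (0 < P A)%E.

Let first_hit k x := A (iter k S x) /\ forall j, (j < k)%N -> ~ A (iter j S x).

(* The number of backward steps to the last visit of [A], with the junk value 0 on the
   null set of points that never visited [A]. *)
Definition marker_height x : nat := xget 0%N (first_hit ^~ x).

Let never : set X := [set x | forall k, ~ A (iter k S x)].

Let first_hitP x : ~ never x -> exists k, first_hit k x.
Proof.
move=> /existsNP[k /contrapT hk].
have ex : exists k, `[< A (iter k S x) >] by exists k; apply/asboolP.
case: (ex_minnP ex) => m /asboolP hm minm; exists m; split => // j jm hj.
by have := minm j (asboolT hj); rewrite leqNgt jm.
Qed.

Let first_hit_uniq x k l : first_hit k x -> first_hit l x -> k = l.
Proof.
move=> [hk mk] [hl ml]; case: (ltngtP k l) => // h.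
  by case: (ml _ h).
by case: (mk _ h).
Qed.

Let heightE x k : first_hit k x -> marker_height x = k.
Proof.
move=> hk; have h : (first_hit ^~ x) (marker_height x).
  exact: (@xgetI _ 0%N (fun j => first_hit j x) k hk).
exact: first_hit_uniq h hk.
Qed.

Let mAk k : measurable (iter k S @^-1` A).
Proof. by rewrite -[_ @^-1` _]setTI; exact: measurable_iter_inverse. Qed.

Let mfirst k : measurable (first_hit k).
Proof.
rewrite (_ : first_hit k = iter k S @^-1` A `&`
    \bigcap_(j in [set j | (j < k)%N]) ~` (iter j S @^-1` A)) //.
apply: measurableI => //; apply: bigcap_measurableType => j _.
exact: measurableC.
Qed.

Let mnever : measurable never.
Proof.
rewrite (_ : never = \bigcap_k ~` (iter k S @^-1` A)).
  by apply: bigcapT_measurable => k; exact: measurableC.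
by apply/seteqP; split => x h k; [move=> _|]; exact: h.
Qed.

Lemma mlabel_marker_height : mlabel marker_height.
Proof.
apply: mlabel_countable => l.
have -> : marker_height @^-1` [set l] = first_hit l `|` (if l == 0%N then never else set0).
  apply/seteqP; split => x /=.
    have [nx|/first_hitP[k hk]] := pselect (never x); last first.
      by rewrite (heightE hk) => <-; left.
    rewrite /marker_height xgetPN; last by move=> k [hk _]; exact: (nx k).
    by move=> <-; right.
  case; first exact: heightE.
  case: eqP => // -> nx; rewrite /marker_height xgetPN// => k [hk _].
  exact: (nx k).
by apply: measurableU => //; case: ifP.
Qed.

(** The past of [iter j T x] contains that of [x], so the preimages of [never] decrease. They have
    equal measure, and their intersection is invariant and disjoint from [A]; ergodicity makes it
    null because [A] is not. *)
Let never_null : P never = 0%E.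
Proof.
pose N j := iter j T @^-1` never.
have mN j : measurable (N j).
  by rewrite /N -[_ @^-1` _]setTI; exact: (measurable_iter mpT).
have NS j : N j.+1 `<=` N j.
  move=> x h k; have := h k.+1; rewrite /= -iterS iterSr TK.
  exact.
have dec : nonincreasing_seq N.
  by apply/nonincreasing_seqP => j; apply/subsetPset.
have mNoo : measurable (\bigcap_j N j) by exact: bigcapT_measurable.
have cv : P (N j) @[j --> \oo] --> P (\bigcap_j N j).
  apply: nonincreasing_cvg_mu => //.
  by rewrite (le_lt_trans (probability_le1 P _))// ltry.
have PN j : P (N j) = P never by exact: preserving_iter.
have <- : P (\bigcap_j N j) = P never.
  have := cv; under eq_fun do rewrite PN.
  move=> /cvg_lim <-//; exact: lim_cst.
have inv : T @^-1` (\bigcap_j N j) = \bigcap_j N j.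
  apply/seteqP; split => x h j _.
    by apply: NS; have := h j Logic.I; rewrite /N /preimage/= -iterSr.
  by have := h j.+1 Logic.I; rewrite /N /preimage/= -iterSr.
case: (ergT mNoo inv) => // P1; exfalso.
have : P A = 0%E.
  have : P (~` \bigcap_j N j) = 0%E by rewrite probability_setC// P1 subee.
  apply: subset_measure0 => //; first exact: measurableC.
  by move=> x Ax /(_ 0%N Logic.I)/(_ 0%N).
by move=> PA0; have := PA_gt0; rewrite PA0 ltxx.
Qed.

Let height_step x : ~ never x -> ~ A (T x) -> marker_height (T x) = (marker_height x).+1.
Proof.
move=> /first_hitP[k hk] nA; rewrite (heightE hk); apply: heightE.
case: hk => hk mk; split; first by rewrite iterSr TK.
by case=> [_|j jk]; [exact: nA|rewrite iterSr TK; exact: mk].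
Qed.

Definition marker_defect : set X := [set x | marker_height (T x) != (marker_height x).+1].

Lemma measurable_marker_defect : measurable marker_defect.
Proof.
have h := mlabel_pair (mlabel_pre mT mlabel_marker_height) mlabel_marker_height.
exact: (h [set u | u.1 != u.2.+1]).
Qed.

(** The height fails to grow by one only when the orbit enters [A] or when the past never met
    [A]. *)
Lemma marker_defect_le : (P marker_defect <= P A)%E.
Proof.
have mTA : measurable (T @^-1` A) by rewrite -[_ @^-1` _]setTI; exact: mT.
apply: (@le_trans _ _ (P (T @^-1` A `|` never))).
  apply: le_measure; rewrite ?inE//; first exact: measurable_marker_defect.
    exact: measurableU.
  move=> x /eqP hx; have [h1|h1] := pselect (never x); first by right.
  have [h2|h2] := pselect (A (T x)); first by left.
  by case: hx; exact: height_step.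
apply: le_trans (measureU2 _ mTA mnever) _.
rewrite [X in (_ + X)%E](_ : _ = 0%E)// adde0.
by rewrite [leLHS](_ : _ = P A)//; exact: (proj2 mpT).
Qed.

End MarkerHeight.

Lemma ae_label {d : measure_display} {R : realType} {X : measurableType d}
  (P : probability X R) (L : finType) (W : X -> L) (Q : pred L) : mlabel W ->
  (forall l, ~~ Q l -> P (W @^-1` [set l]) = 0%E) -> {ae P, forall x, Q (W x)}.
Proof.
move=> mW h; exists [set x | ~~ Q (W x)]; split.
- exact: (mW [set l | ~~ Q l]).
- transitivity (\sum_(l | ~~ Q l) cprob (fun _ : X => P) W l point)%:E.
    by rewrite (sum_cprob_pred (fun _ : X => P) mW (fun l => ~~ Q l)).
  by rewrite big1// => l /h; rewrite /cprob => ->.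
- by move=> x /= /negP.
Qed.

(** * Measures without sets of small positive mass *)

Section AtomicCase.
Context {d dZ : measure_display} {R : realType} {X : measurableType d}
  {Z : measurableType dZ}.
Variables (P : probability X R) (p : X -> Z) (kappa : Z -> probability X R).
Variables (T : X -> X) (T' : Z -> Z).
Hypothesis setting : factor_setting P p kappa T T'.
Variables (L : finType) (W : X -> L).
Hypothesis mW : mlabel W.
Variable a : R.
Hypothesis a_gt0 : 0 < a.
Hypothesis gap : forall A, measurable A -> P A = 0%E \/ (a%:E <= P A)%E.

(** Almost every point has a word of [P]-mass at least [a]. Gibbs' inequality against half the law
    of the words plus half the uniform law bounds all block entropies by [ln 2 - ln a], and a
    positive rate would make them grow linearly. *)
Lemma entropy_rate_atomic : entropy_rate P p kappa T W = 0.
Proof.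
have [condP mpT _ _] := setting.
have mT : measurable_fun setT T by case: mpT.
have mword n : mlabel (word T W n) by exact: mlabel_word.
apply/eqP; rewrite eq_le (entropy_rate_ge0 setting mW) andbT.
have a1 : a <= 1.
  have [] := gap (measurableT : measurable [set: X]); rewrite probability_setT.
    by move=> /eqP; rewrite onee_eq0.
  by rewrite lee_fin.
pose K : R := #|L|%:R.
have K0 : 0 < K by rewrite ltr0n; apply/card_gt0P; exists (W point).
pose C := ln 2 - ln a.
have bound n : (block_entropy P p kappa T W n <= C%:E)%E.
  pose mass (u : n.-tuple L) : R := fine (P (word T W n @^-1` [set u])).
  have massE u : (mass u)%:E = P (word T W n @^-1` [set u]).
    by rewrite fineK// fin_num_measure//; exact: mword.
  have mass0 u : 0 <= mass u by exact: fine_ge0.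
  pose q u (z : Z) := mass u / 2 + (K ^- n) / 2.
  have q0 u z : 0 < q u z.
    by rewrite /q ltr_wpDl ?divr_ge0// divr_gt0// invr_gt0 exprn_gt0.
  have qs z : \sum_u q u z <= 1.
    rewrite big_split/= -mulr_suml sumr_const card_tuple.
    rewrite [X in X / 2 + _](_ : _ = 1); last exact: (sum_cprob (fun _ : X => P) (@mword n) point).
    rewrite -[X in _ + X]mulr_natr mulrAC natrX mulVf ?gt_eqF ?exprn_gt0//; lra.
  apply: (le_trans (gibbs_ineq condP (@mword n) (fun u => measurable_cst _)
    (fun u z => ltW (q0 u z)) qs q0)).
  rewrite -[leRHS]mule1 -(probability_setT P) -integral_cst//.
  have mq : measurable_fun setT (fun x => (- ln (q (word T W n x) (p x)))%:E).
    apply/measurable_EFinP.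
    exact: (measurable_of_label (fun u => - ln (q u (p point))) (@mword n)).
  apply: ae_ge0_le_integral => //.
  - move=> x _; rewrite lee_fin oppr_ge0 ln_le0//.
    apply: le_trans (qs (p x)); rewrite (bigD1 (word T W n x))//= lerDl sumr_ge0// => u _.
    exact: ltW.
  - by move=> x _; rewrite lee_fin /C subr_ge0 ler_ln ?posrE//; lra.
  have := @ae_label _ _ _ P _ (word T W n) (fun u => a <= mass u) (@mword n).
  case=> [u|N [mN PN sN]].
    rewrite -ltNge => hu; have [//|] := gap (@mword n [set u]).
    by rewrite -massE lee_fin leNgt hu.
  exists N; split => // x nx; apply: sN => hx; apply: nx => _.
  rewrite lee_fin /C lerNl opprB -ln_div ?posrE//.
  rewrite ler_ln ?posrE ?divr_gt0//; last exact: (q0 _ (p x)).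
  by rewrite /q ler_wpDr ?divr_ge0 ?invr_ge0 ?exprn_ge0 ?(ltW K0)// ler_pM2r.
rewrite leNgt; apply/negP => h0.
have [M hM] : exists M : nat, C < M%:R * entropy_rate P p kappa T W.
  exists (Num.truncn (C / entropy_rate P p kappa T W)).+1.
  by rewrite -ltr_pdivrMr// truncnS_gt.
have := le_trans (block_entropy_ge setting mW M) (bound M).
by rewrite lee_fin leNgt hM.
Qed.

End AtomicCase.

(** * Prefix weights of a family of words *)

Section PrefixWeight.
Context {R : realType} (I : finType) (n : nat).
Implicit Types (F : {set n.-tuple I}) (s : seq I) (w : n.-tuple I).

Let K : R := #|I|%:R.

(* Half of the mass is the proportion of [F] extending [s], the other half is
   the uniform one; the latter keeps the weight bounded away from 0. *)
Definition prefix_weight F s : R :=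
  (\sum_(w in F) (take (size s) w == s)%:R) / #|F|%:R / 2 + K ^- (size s) / 2.

Hypothesis I_gt0 : (0 < #|I|)%N.
Let K_ge1 : 1 <= K. Proof. by rewrite ler1n. Qed.
Let K_gt0 : 0 < K. Proof. exact: lt_le_trans ltr01 K_ge1. Qed.

Let count_ge0 F s : 0 <= (\sum_(w in F) (take (size s) w == s)%:R) / #|F|%:R :> R.
Proof. by rewrite divr_ge0// sumr_ge0. Qed.

Lemma prefix_weight_ge F s : K ^- (size s) / 2 <= prefix_weight F s.
Proof. by rewrite lerDr divr_ge0. Qed.

Lemma prefix_weight_gt0 F s : 0 < prefix_weight F s.
Proof.
apply: lt_le_trans (prefix_weight_ge F s).
by rewrite divr_gt0// invr_gt0 exprn_gt0.
Qed.

Lemma prefix_weight_le1 F s : prefix_weight F s <= 1.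
Proof.
have h : K ^- (size s) <= 1 by rewrite invf_le1 ?exprn_gt0// exprn_ege1.
have : (\sum_(w in F) (take (size s) w == s)%:R) / #|F|%:R <= 1 :> R.
  have [->|F0] := eqVneq #|F| 0%N; first by rewrite invr0 mulr0.
  rewrite ler_pdivrMr ?ltr0n ?lt0n// mul1r -sumr_const.
  by apply: ler_sum => w _; case: (_ == _).
rewrite /prefix_weight; lra.
Qed.

Lemma prefix_weight_nil F : (0 < #|F|)%N -> prefix_weight F [::] = 1.
Proof.
move=> F0; rewrite /prefix_weight expr0 invr1.
under eq_bigr do rewrite take0 eqxx.
by rewrite sumr_const divff ?pnatr_eq0 -?lt0n//; lra.
Qed.

(** For nonempty [F] the weight of [s] is the mass of the words extending [s] under an even mixture
    of the uniform laws on [F] and on all words. Quotients of successive weights are therefore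
    conditional probabilities of letters. *)
Lemma sum_prefix_weight F s : (size s < n)%N ->
  \sum_a prefix_weight F (rcons s a) = prefix_weight F s.
Proof.
have /card_gt0P[i0 _] := I_gt0.
move=> sn; rewrite big_split/= -!mulr_suml; congr (_ / _ / _ + _ / _).
  rewrite exchange_big/=; apply: eq_bigr => w _.
  have tw : take (size s).+1 w = rcons (take (size s) w) (nth i0 w (size s)).
    by rewrite (take_nth i0)// size_tuple.
  under eq_bigr do rewrite size_rcons tw eqseq_rcons.
  have [_|_] := boolP (take (size s) w == s); last by rewrite big1.
  by rewrite (bigD1 (nth i0 w (size s)))//= eqxx big1 ?addr0// => a /negbTE; rewrite eq_sym => ->.
under eq_bigr do rewrite size_rcons.
rewrite sumr_const -mulr_natl exprS invfM mulrA divff ?mul1r//.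
by rewrite gt_eqF.
Qed.

Lemma prefix_weight_rcons F s a : (size s < n)%N ->
  prefix_weight F (rcons s a) <= prefix_weight F s.
Proof.
move=> sn; rewrite -(sum_prefix_weight F sn) (bigD1 a)//= lerDl sumr_ge0// => b _.
exact/ltW/prefix_weight_gt0.
Qed.

Lemma prefix_weight_mem F w : w \in F ->
  - ln (prefix_weight F w) <= ln 2 + ln #|F|%:R.
Proof.
move=> wF; have F0 : 0 < #|F|%:R :> R by rewrite ltr0n; apply/card_gt0P; exists w.
rewrite lerNl opprD -lnV ?posrE// -lnV ?posrE// -lnM ?posrE ?invr_gt0//.
rewrite ler_ln ?posrE ?mulr_gt0 ?invr_gt0 ?prefix_weight_gt0// mulrC /prefix_weight.
rewrite ler_wpDr ?divr_ge0 ?invr_ge0 ?exprn_ge0 ?(ltW K_gt0)//.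
rewrite ler_pM2r ?invr_gt0// -[leLHS]mul1r ler_pM2r ?invr_gt0//.
by rewrite (bigD1 w)//= size_tuple take_oversize ?size_tuple// eqxx lerDl sumr_ge0.
Qed.

Lemma prefix_weight_all F s : - ln (prefix_weight F s) <= ln 2 + (size s)%:R * ln K.
Proof.
rewrite lerNl opprD -lnV ?posrE// mulr_natl -lnXn// -lnV ?posrE ?exprn_gt0//.
rewrite -lnM ?posrE ?invr_gt0 ?exprn_gt0//.
rewrite ler_ln ?posrE ?mulr_gt0 ?invr_gt0 ?prefix_weight_gt0 ?exprn_gt0// mulrC.
exact: prefix_weight_ge.
Qed.

End PrefixWeight.

Lemma mlabel_glue {d : measure_display} {X : measurableType d} (J : countType)
  (L : Type) (phi : X -> J) (A : J -> X -> L) :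
  mlabel phi -> (forall j, mlabel (A j)) -> mlabel (fun x => A (phi x) x).
Proof.
move=> mphi mA B.
have -> : (fun x => A (phi x) x) @^-1` B =
    \bigcup_(j in [set: J]) (phi @^-1` [set j] `&` A j @^-1` B).
  by apply/seteqP; split => [x Bx|x [j _ [/= <-]]//]; exists (phi x).
apply: countable_bigcupT_measurable => [|j]; first exact: countableP.
by apply: measurableI; [exact: mphi|exact: mA].
Qed.

Section ClockCode.
Context {d dZ : measure_display} {R : realType} {X : measurableType d}
  {Z : measurableType dZ}.
Variables (P : probability X R) (p : X -> Z) (kappa : Z -> probability X R).
Variables (T S : X -> X) (T' : Z -> Z).
Hypothesis setting : factor_setting P p kappa T T'.
Hypothesis mS : measurable_fun setT S.
Hypothesis TK : cancel T S.

Let condP : conditional P p kappa. Proof. by case: setting. Qed.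
Let mpT : measure_preserving P T. Proof. by case: setting. Qed.
Let mT : measurable_fun setT T. Proof. by case: mpT. Qed.
Let mT' : measurable_fun setT T'. Proof. by case: setting. Qed.
Let mp : measurable_fun setT p. Proof. by case: condP. Qed.

Variables (I : finType) (i0 : I) (n : nat).
Hypothesis n_gt0 : (0 < n)%N.
Variables (phi : X -> 'I_n) (F : Z -> {set n.-tuple I}) (omega : X -> n.-tuple I).
Hypothesis mphi : mlabel phi.
Hypothesis mF : mlabel F.
Hypothesis momega : mlabel omega.
Hypothesis F_gt0 : forall z, (0 < #|F z|)%N.

(** Position [phi x] of the word chosen [phi x] steps earlier describes the present point, so the
    letter is correct even if the clock was irregular in between. *)
Definition code_letter x : I := nth i0 (omega (iter (phi x) S x)) (phi x).

(** The clock is carried along to tell the predictor where the block began; [entropy_rate_comp]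
    removes it in the end. *)
Definition clock_code x : I * 'I_n := (code_letter x, phi x).

Definition clock_defect : set X := 
  [set x | phi (T x) != ((phi x).+1 %% n)%N :> nat].

Lemma mlabel_code_letter : mlabel code_letter.
Proof.
apply: (mlabel_glue (A := fun (j : 'I_n) x => nth i0 (omega (iter j S x)) j)) => // j.
apply: (mlabel_comp (fun w : n.-tuple I => nth i0 w j)).
exact: (mlabel_pre (measurable_iter_inverse mS j) momega).
Qed.

Lemma mlabel_clock_code : mlabel clock_code.
Proof. by apply: mlabel_pair => //; exact: mlabel_code_letter. Qed.

Lemma measurable_clock_defect : measurable clock_defect.
Proof.
have h := mlabel_pair (mlabel_pre mT mphi) mphi.
exact: (h [set u : 'I_n * 'I_n | u.1 != (u.2.+1 %% n)%N :> nat]).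
Qed.

Let K : R := #|I|%:R.
Let I_gt0 : (0 < #|I|)%N. Proof. by apply/card_gt0P; exists i0. Qed.
Let K_ge1 : 1 <= K. Proof. by rewrite ler1n. Qed.
Let K_gt0 : 0 < K. Proof. exact: lt_le_trans ltr01 K_ge1. Qed.
Let wt (G : {set n.-tuple I}) s : R := prefix_weight G s.

Variable e : R.
Hypothesis e01 : 0 < e < 1.
Let e_gt0 : 0 < e. Proof. by case/andP: e01. Qed.
Let e_lt1 : e < 1. Proof. by case/andP: e01. Qed.

Let o0 : 'I_n := Ordinal n_gt0.

Definition clock_transition (i k : nat) : R :=
  (1 - e) * (k == i.+1 %% n)%N%:R + e / n%:R.

(* The clock value [k] says that the current letter has index [k] in its block;
   the preceding [k] letters and the fibre at the beginning of the block then
   determine the conditional weight of the letter. *)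
Definition clock_predictor (z : Z) (u : seq (I * 'I_n)) : R :=
  let k : nat := (last (i0, o0) u).2 in
  let past := take n u in
  let s := map fst (drop (n - k) past) in
  let G := F (iter (n - k) T' z) in
  clock_transition (last (i0, o0) past).2 k *
    (wt G (rcons s (last (i0, o0) u).1) / wt G s).

Let n_gt0R : 0 < n%:R :> R. Proof. by rewrite ltr0n. Qed.

Let transition_ge i k : e / n%:R <= clock_transition i k.
Proof. by rewrite lerDr mulr_ge0// subr_ge0 ltW. Qed.

Let wt_gt0 G s : 0 < wt G s. Proof. exact: prefix_weight_gt0. Qed.

(** The least transition probability times the least weight of a prefix of length at most [n]. It
    does not involve [phi], so it is known before the clock is built. *)
Definition clock_floor : R := e / n%:R * (K ^- n / 2).

Lemma predictor_clock : predictor n clock_floor clock_predictor.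
Proof.
split.
- by rewrite mulr_gt0 ?divr_gt0// invr_gt0 exprn_gt0.
- move=> u; rewrite /clock_predictor.
  set k : nat := (last (i0, o0) u).2; set s := map _ _; set t := clock_transition _ _.
  have mi : measurable_fun setT (iter (n - k) T').
    by elim: (n - k)%N => [|j IH] /=; [exact: measurable_id|exact: measurableT_comp].
  exact: (measurable_of_label
    (fun G : {set n.-tuple I} => t * (wt G (rcons s (last (i0, o0) u).1) / wt G s))
    (mlabel_pre mi mF)).
- move=> z u un; rewrite /clock_predictor /clock_floor.
  set k := (last (i0, o0) u).2; set s := map _ _; set G := F _.
  have ss : size s = k.
    rewrite size_map size_drop size_takel ?un// subKn//; exact/ltnW/ltn_ord.
  apply: ler_pM; rewrite ?divr_ge0 ?invr_ge0 ?exprn_ge0 ?(ltW e_gt0) ?(ltW K_gt0)//.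
  apply: (@le_trans _ _ (wt G (rcons s (last (i0, o0) u).1))).
    apply: le_trans (prefix_weight_ge _ _); rewrite size_rcons ss ler_pM2r ?invr_gt0//.
    by rewrite lef_pV2 ?posrE ?exprn_gt0// ler_weXn2l// ltn_ord.
  by rewrite ler_peMr ?(ltW (wt_gt0 _ _))// invf_ge1 ?prefix_weight_le1// wt_gt0.
- move=> z u un; set prev := (last (i0, o0) u).2.
  pose s (k : 'I_n) := map fst (drop (n - k) u).
  have cE l : clock_predictor z (rcons u l) = clock_transition prev l.2 *
      (wt (F (iter (n - l.2) T' z)) (rcons (s l.2) l.1) / wt (F (iter (n - l.2) T' z)) (s l.2)).
    by rewrite /clock_predictor last_rcons -cats1 take_size_cat.
  under eq_bigr do rewrite cE.
  rewrite -(pair_bigA _ (fun (a : I) (k : 'I_n) => clock_transition prev k *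
    (wt (F (iter (n - k) T' z)) (rcons (s k) a) / wt (F (iter (n - k) T' z)) (s k))))/=.
  rewrite exchange_big/=.
  (* For each clock value the letters sum to 1 by consistency of the prefix weights; the transitions
     then sum to 1. *)
  under eq_bigr => k _.
    rewrite -mulr_sumr -mulr_suml sum_prefix_weight//; last first.
      by rewrite size_map size_drop un subKn ?ltn_ord// ltnW.
    rewrite divff ?mulr1; last by rewrite gt_eqF// wt_gt0.
    over.
  rewrite big_split/= -mulr_sumr sumr_const card_ord -[(e / _) *+ n]mulr_natr divfK ?gt_eqF//.
  have pn : (prev.+1 %% n < n)%N by rewrite ltn_mod.
  rewrite (bigD1 (Ordinal pn))//= eqxx big1 ?addr0 ?mulr1 ?subrK// => k kp.
  by case: eqP => // kE; case/eqP: kp; apply: val_inj.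
Qed.

(** The cost of the letter of index [k] in a block starting at [v], set to 0 when no block starts
    there. *)
Let g (k : nat) (v : X) : R := if phi v == 0%N :> nat then
  ln (wt (F (p v)) (take k (omega v))) - ln (wt (F (p v)) (take k.+1 (omega v))) else 0.

Let take_step k v : (k < n)%N ->
  take k.+1 (omega v) = rcons (take k (omega v)) (nth i0 (omega v) k).
Proof. by move=> kn; rewrite (take_nth i0)// size_tuple. Qed.

Let g_ge0 k v : (k < n)%N -> 0 <= g k v.
Proof.
move=> kn; rewrite /g; case: ifP => // _; rewrite subr_ge0.
rewrite ler_ln ?posrE ?wt_gt0// take_step//; apply: prefix_weight_rcons => //.
by rewrite size_takel// size_tuple ltnW.
Qed.

Let lab v := (F (p v), omega v, phi v).
Let mlab : mlabel lab.
Proof. by apply: mlabel_pair => //; apply: mlabel_pair => //; exact: (mlabel_pre mp mF). Qed.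

Let mg k : measurable_fun setT (g k).
Proof.
exact: (measurable_of_label (fun l : {set n.-tuple I} * n.-tuple I * 'I_n =>
  if l.2 == 0%N :> nat then
  ln (wt l.1.1 (take k l.1.2)) - ln (wt l.1.1 (take k.+1 l.1.2)) else 0) mlab).
Qed.

(** Read backwards from time [n], a clock without defects decreases by one until it reaches 0; the
    reduction modulo [n] can only act at the start of a block. *)
Let clock_back x : (forall i, (i < n)%N -> ~ clock_defect (iter i T x)) ->
  forall j, (j <= phi (iter n T x))%N -> phi (iter (n - j) T x) = (phi (iter n T x) - j)%N :> nat.
Proof.
move=> nod; elim=> [|j IH] jk; first by rewrite !subn0.
have jn : (j < n)%N by apply: leq_trans jk (ltnW (ltn_ord _)).
have hlt : (n - j.+1 < n)%N by rewrite ltn_subrL.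
have := nod _ hlt; rewrite /clock_defect/= => /negP; rewrite negbK => /eqP.
rewrite -iterS subnSK// IH 1?ltnW//.
have := ltn_ord (phi (iter (n - j.+1) T x)).
rewrite leq_eqVlt => /predU1P[->|h].
  by rewrite modnn => /eqP; rewrite subn_eq0 leqNgt jk.
rewrite modn_small// => hk; apply: succn_inj; rewrite -hk subnSK//.
Qed.

(** Without defects among the [n] steps, the block of the last letter starts inside the window, so
    the predictor has seen the whole prefix and its quotient of weights is the right one. With a
    defect the crude bound by [clock_floor] is paid by an indicator. *)
Lemma clock_cost x : pcost p T clock_code n clock_predictor x <=
  - ln (1 - e) + (- ln clock_floor) * (\sum_(i < n) \1_clock_defect (iter i T x))
    + \sum_(k < n) g k (iter (n - k) T x).
Proof.
have gs0 : 0 <= \sum_(k < n) g k (iter (n - k) T x).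
  by apply: sumr_ge0 => k _; exact: g_ge0.
have fl_gt0 : 0 < clock_floor by case: predictor_clock.
have le1 : - ln clock_floor >= 0.
  exact: le_trans (pcost_ge0 p T clock_code predictor_clock x)
    (pcost_le p T clock_code predictor_clock x).
have lne : 0 <= - ln (1 - e) by rewrite oppr_ge0 ln_le0// gerBl ltW.
have [[i [inn hi]]|nod] := pselect (exists i, (i < n)%N /\ clock_defect (iter i T x)).
  apply: (le_trans (pcost_le p T clock_code predictor_clock x)).
  apply: ler_wpDr => //; apply: ler_wpDl => //.
  rewrite ler_peMr// (bigD1 (Ordinal inn))//= indicE mem_set// lerDl sumr_ge0//.
have {}nod i : (i < n)%N -> ~ clock_defect (iter i T x).
  by move=> inn hi; apply: nod; exists i.
have back := clock_back nod.
set k := phi (iter n T x) in back.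
have kn : (k < n)%N := ltn_ord k.
set v := iter (n - k) T x.
have Tv i : (i <= k)%N -> iter i T v = iter (n - (k - i)) T x.
  move=> ik; rewrite /v -iterD; congr (iter _ T x).
  by move: (nat_of_ord k) ik kn => k' ik kn; lia.
have phiv i : (i <= k)%N -> phi (iter i T v) = i :> nat.
  by move=> ik; rewrite Tv// back ?leq_subr// subKn.
have letter i : (i <= k)%N -> code_letter (iter i T v) = nth i0 (omega v) i.
  by move=> ik; rewrite /code_letter phiv// iterK.
have uE : wseq T clock_code n.+1 x = rcons (wseq T clock_code n x) (clock_code (iter n T x)).
  exact: wseqS.
have Tkv : iter n T x = iter k T v by rewrite Tv// subnn subn0.
have sE : map fst (drop (n - k) (wseq T clock_code n x)) = take k (omega v).
  have -> : wseq T clock_code n x = wseq T clock_code (n - k + k) x.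
    by rewrite subnK// ltnW.
  rewrite drop_wseq -/v.
  apply: (@eq_from_nth _ i0).
    by rewrite size_map size_wseq size_takel// size_tuple ltnW.
  move=> i; rewrite size_map size_wseq => ik.
  rewrite (nth_map (i0, o0)) ?size_wseq// nth_mkseq//= nth_take//.
  exact/letter/ltnW.
have cE : clock_predictor (p x) (wseq T clock_code n.+1 x) =
    clock_transition (phi (iter n.-1 T x)) k *
    (wt (F (p v)) (take k.+1 (omega v)) / wt (F (p v)) (take k (omega v))).
  rewrite /clock_predictor uE last_rcons -cats1 take_size_cat ?size_wseq//=.
  rewrite -/k sE take_step// /v (factor_iter setting) Tkv letter//.
  congr (clock_transition _ _ * _).
  have -> : wseq T clock_code n x = wseq T clock_code n.-1.+1 x by rewrite prednK.
  by rewrite wseqS last_rcons.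
(* The last step of the window is not a defect, so the clock followed the transition of mass at
   least [1 - e]. *)
have trE : 1 - e <= clock_transition (phi (iter n.-1 T x)) k.
  have := nod n.-1; rewrite prednK// => /(_ (leqnn _)).
  rewrite /clock_defect/= => /negP; rewrite negbK -iterS prednK// -/k => /eqP ek.
  by rewrite /clock_transition -ek eqxx mulr1 lerDl divr_ge0// ltW.
have gk : g k v = ln (wt (F (p v)) (take k (omega v))) - ln (wt (F (p v)) (take k.+1 (omega v))).
  by rewrite /g; have := phiv 0%N (leq0n _); rewrite /= => ->.
have tr0 : 0 < clock_transition (phi (iter n.-1 T x)) k.
  by apply: lt_le_trans trE; rewrite subr_gt0.
(* The index [k] depends on [x]; summing over all indices gives a bound whose terms can be
   integrated separately. *)
have gle : g k v <= \sum_(k < n) g k (iter (n - k) T x).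
  by rewrite (bigD1 k)//= lerDl sumr_ge0// => j _; exact: g_ge0.
have in0 : 0 <= (- ln clock_floor) * (\sum_(i < n) \1_clock_defect (iter i T x)).
  by rewrite mulr_ge0// sumr_ge0.
have lntr : ln (1 - e) <= ln (clock_transition (phi (iter n.-1 T x)) k).
  by rewrite ler_ln ?posrE// subr_gt0.
rewrite /pcost cE lnM ?posrE ?divr_gt0// ln_div ?posrE//.
lra.
Qed.

Definition block_cost v : R :=
  if phi v == 0%N :> nat then - ln (wt (F (p v)) (omega v)) else 0.

Lemma block_cost_ge0 v : 0 <= block_cost v.
Proof. by rewrite /block_cost; case: ifP => // _; rewrite oppr_ge0 ln_le0// prefix_weight_le1. Qed.

Lemma measurable_block_cost : measurable_fun setT block_cost.
Proof.
exact: (measurable_of_label (fun l : {set n.-tuple I} * n.-tuple I * 'I_n =>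
  if l.2 == 0%N :> nat then - ln (wt l.1.1 l.1.2) else 0) mlab).
Qed.

(** The differences telescope from the empty prefix, of weight 1, to the whole word. *)
Let sum_g v : \sum_(k < n) g k v = block_cost v.
Proof.
rewrite /g /block_cost; case: ifP => _; last by rewrite big1.
pose h k : R := - ln (wt (F (p v)) (take k (omega v))).
transitivity (\sum_(0 <= k < n) (h k.+1 - h k)).
  by rewrite big_mkord; apply: eq_bigr => k _; rewrite /h opprK addrC.
rewrite telescope_sumr// /h take0 /wt prefix_weight_nil// ln1 !oppr0 addr0.
by rewrite take_oversize// size_tuple.
Qed.

(** In the integral of [clock_cost], invariance moves the terms of all indices [k] to the same
    point, where they add up to the cost of a whole block. *)
Lemma entropy_rate_clock_code :
  ((entropy_rate P p kappa T clock_code)%:E <= (- ln (1 - e))%:E +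
    (- ln clock_floor)%:E * (n%:R%:E * P clock_defect)
    + \int[P]_v (block_cost v)%:E)%E.
Proof.
apply: (le_trans (entropy_rate_predictor setting mlabel_clock_code predictor_clock)).
have pc := predictor_clock.
have C0 : - ln clock_floor >= 0.
  exact: le_trans (pcost_ge0 p T clock_code pc point) (pcost_le p T clock_code pc point).
have lne : 0 <= - ln (1 - e) by rewrite oppr_ge0 ln_le0// gerBl ltW.
have mD i : measurable_fun setT (fun x => (\1_clock_defect (iter i T x))%:E : \bar R).
  apply/measurable_EFinP.
  have mI : measurable_fun setT (\1_clock_defect : X -> R).
    exact: measurable_indic measurable_clock_defect.
  exact: (measurableT_comp mI (measurable_iter mpT i)).
have mgi k i : measurable_fun setT (fun x => (g k (iter i T x))%:E).
  by apply/measurable_EFinP; exact: (measurableT_comp (mg k) (measurable_iter mpT i)).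
apply: (@le_trans _ _ (\int[P]_x ((- ln (1 - e))%:E +
   (- ln clock_floor)%:E * (\sum_(i < n) (\1_clock_defect (iter i T x))%:E)
   + \sum_(k < n) (g k (iter (n - k) T x))%:E))%E).
  apply: ge0_le_integral => //.
  - by move=> x _; rewrite lee_fin (pcost_ge0 p T clock_code pc).
  - by apply/measurable_EFinP; exact: (measurable_pcost setting mlabel_clock_code pc).
  - apply: emeasurable_funD; last exact: emeasurable_sum.
    apply: emeasurable_funD => //; apply: emeasurable_funM => //; exact: emeasurable_sum.
  - by move=> x _; rewrite !sumEFin -EFinM -!EFinD lee_fin clock_cost.
rewrite ge0_integralD//; last 4 first.
- move=> x _; rewrite adde_ge0 ?mule_ge0 ?lee_fin//.
  by rewrite sumEFin lee_fin sumr_ge0.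
- apply: emeasurable_funD => //; apply: emeasurable_funM => //; exact: emeasurable_sum.
- by move=> x _; rewrite sumEFin lee_fin sumr_ge0// => k _; exact: g_ge0.
- exact: emeasurable_sum.
have -> : (\int[P]_x (\sum_(k < n) (g k (iter (n - k) T x))%:E) = \int[P]_v (block_cost v)%:E)%E.
  under [in RHS]eq_integral do rewrite -sum_g -sumEFin.
  rewrite [LHS]ge0_integral_sum//; last by move=> k x _; rewrite lee_fin g_ge0.
  rewrite [RHS]ge0_integral_sum//; last 2 first.
  - by move=> k; apply/measurable_EFinP; exact: mg.
  - by move=> k x _; rewrite lee_fin g_ge0.
  apply: eq_bigr => k _.
  rewrite (integral_preserving_iter mpT (n - k) (f := fun x => (g k x)%:E))//.
    by apply/measurable_EFinP; exact: mg.
  by move=> x; rewrite lee_fin g_ge0.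
apply: leeD2r.
rewrite ge0_integralD//; last 2 first.
- by move=> x _; rewrite mule_ge0 ?lee_fin// sumEFin lee_fin sumr_ge0.
- by apply: emeasurable_funM => //; exact: emeasurable_sum.
rewrite integral_cst//= probability_setT mule1 leeD2l// ge0_integralZl//; last 2 first.
- exact: emeasurable_sum.
- by move=> x _; rewrite sumEFin lee_fin sumr_ge0.
apply: lee_wpmul2l; first by rewrite lee_fin.
rewrite ge0_integral_sum//.
under eq_bigr => i _.
  rewrite (integral_preserving_iter mpT i (f := fun x => (\1_clock_defect x)%:E)); last 2 first.
  - by apply/measurable_EFinP/measurable_indic; exact: measurable_clock_defect.
  - by move=> x; rewrite lee_fin.
  rewrite integral_indic//; last exact: measurable_clock_defect.
  rewrite setIT.
  over.
elim: (n) => [|m IH]; first by rewrite big_ord0 mul0e.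
rewrite big_ord_recr/= -addn1 natrD EFinD ge0_muleDl ?lee_fin// mul1e.
by rewrite leeD2r.
Qed.

End ClockCode.

Section FactorLabel.
Context {d dZ : measure_display} {R : realType} {X : measurableType d}
  {Z : measurableType dZ}.
Variables (P : probability X R) (p : X -> Z) (kappa : Z -> probability X R).
Variables (T : X -> X) (T' : Z -> Z).
Hypothesis setting : factor_setting P p kappa T T'.
Variables (L L' : finType) (W : X -> L) (h : L -> L').
Hypothesis mW : mlabel W.

(** A word of [W] determines the word of [h \o W], so block entropies decrease; their linear growth
    transfers this to the rates. *)
Lemma entropy_rate_comp :
  entropy_rate P p kappa T (h \o W) <= entropy_rate P p kappa T W.
Proof.
have [condP mpT _ _] := setting.
have mT : measurable_fun setT T by case: mpT.
have mW' : mlabel (h \o W) by exact: mlabel_comp.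
have mword n : mlabel (word T W n) by exact: mlabel_word.
have mword' n : mlabel (word T (h \o W) n) by exact: mlabel_word.
have le n : (block_entropy P p kappa T (h \o W) n <= block_entropy P p kappa T W n)%E.
  apply: ae_ge0_le_integral => //.
  - by move=> x _; rewrite lee_fin (information_ge0 p kappa (@mword' n)).
  - by apply/measurable_EFinP; exact: (measurable_information condP (@mword' n)).
  - by move=> x _; rewrite lee_fin (information_ge0 p kappa (@mword n)).
  - by apply/measurable_EFinP; exact: (measurable_information condP (@mword n)).
  apply: filterS (cprob_gt0_ae condP (@mword n)) => x c0 _.
  rewrite lee_fin /information lerN2.
  have cc : cprob kappa (word T W n) (word T W n x) (p x) <=
      cprob kappa (word T (h \o W) n) (word T (h \o W) n x) (p x).
    rewrite -lee_fin (cprobE _ (@mword n)) (cprobE _ (@mword' n)).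
    apply: le_measure; rewrite ?inE; [exact: mword|exact: mword'|].
    move=> y /= /(congr1 val)/= yx; apply: val_inj => /=.
    have e z : wseq T (h \o W) n z = map h (wseq T W n z).
      by rewrite /wseq /mkseq -map_comp.
    by rewrite !e yx.
  by rewrite ler_ln ?posrE// (lt_le_trans c0 cc).
rewrite leNgt; apply/negP => lt.
set x := (entropy_rate P p kappa T W + entropy_rate P p kappa T (h \o W)) / 2.
have hx : entropy_rate P p kappa T W < x by rewrite /x; lra.
have [N _ hN] := block_entropy_eventually setting mW hx.
have := hN N.+1 (leqnSn N); rewrite /= => h1.
have := le_trans (block_entropy_ge setting mW' N.+1) (le_trans (le N.+1) h1).
by rewrite lee_fin ler_pM2l// leNgt /x; case/negP; lra.
Qed.

End FactorLabel.

(** * Labels subordinate to the cover with small entropy rate *)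

Section KatokLower.
Context {d dZ : measure_display} {R : realType} {X : measurableType d}
  {Z : measurableType dZ}.
Variables (P : probability X R) (p : X -> Z) (kappa : Z -> probability X R).
Variables (T S : X -> X) (T' : Z -> Z).
Hypothesis setting : factor_setting P p kappa T T'.
Hypothesis ergT : ergodic_on P T.
Hypothesis mS : measurable_fun setT S.
Hypothesis TK : cancel T S.
Hypothesis SK : cancel S T.
Variables (I : finType) (V : I -> set X).
Hypothesis mV : forall i, measurable (V i).
Hypothesis covV : forall x, exists i, V i x.
Variable rho : R.
Hypothesis rho01 : 0 < rho < 1.
Variable n : nat.
Hypothesis n_gt0 : (0 < n)%N.

Let condP : conditional P p kappa. Proof. by case: setting. Qed.
Let mpT : measure_preserving P T. Proof. by case: setting. Qed.
Let mT : measurable_fun setT T. Proof. by case: mpT. Qed.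
Let mp : measurable_fun setT p. Proof. by case: condP. Qed.
Let mk A : measurable A -> measurable_fun setT (fun z => kappa z A).
Proof. by case: condP => _ + _; exact. Qed.

Let i0 : I := projT1 (cid (covV point)).
Let K : R := #|I|%:R.
Let K_ge1 : 1 <= K. Proof. by rewrite ler1n; apply/card_gt0P; exists i0. Qed.
Let lnK_ge0 : 0 <= ln K. Proof. exact: ln_ge0. Qed.

Let cyl (w : n.-tuple I) := cylinder T V w.
Let mcyl (w : n.-tuple I) : measurable (cyl w).
Proof. exact: measurable_cylinder. Qed.
Let covcyl x : exists w : n.-tuple I, cyl w x.
Proof. exact: cylinder_cover. Qed.

Definition fibre_family z : {set n.-tuple I} := min_family cyl (kappa z) rho.
Let F := fibre_family.
Let mF : mlabel F. Proof. exact: mlabel_min_family. Qed.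
Let F_gt0 z : (0 < #|F z|)%N. Proof. exact: ncov_gt0. Qed.

Let bits x : {ffun n.-tuple I -> bool} := [ffun w => `[< cyl w x >]].
Let mbits : mlabel bits.
Proof. by apply: mlabel_ffun => w; exact: mlabel_bool. Qed.

(** A word of the family whose cylinder contains the point, or else any word whose cylinder does.
    The choice depends only on finite tables, hence measurably on the point. *)
Definition preferred_word (G : {set n.-tuple I}) (b : {ffun n.-tuple I -> bool}) :
    n.-tuple I :=
  if [pick w | (w \in G) && b w] is Some w then w
  else odflt [tuple i0 | _ < n] [pick w | b w].

Definition itinerary x : n.-tuple I := preferred_word (F (p x)) (bits x).
Let omega := itinerary.

Let momega : mlabel omega.
Proof.
have h := mlabel_pair (mlabel_pre mp mF) mbits.
exact: (mlabel_comp (fun u => preferred_word u.1 u.2) h).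
Qed.

Lemma itinerary_cylinder x : cylinder T V (itinerary x) x.
Proof.
rewrite /itinerary /preferred_word; case: pickP => [w /andP[_]|_].
  by rewrite ffunE => /asboolP.
case: pickP => [w|h] /=; first by rewrite ffunE => /asboolP.
by have [w hw] := covcyl x; have := h w; rewrite ffunE => /asboolP.
Qed.

Definition uncovered : set X := [set x | itinerary x \notin F (p x)].

Lemma measurable_uncovered : measurable uncovered.
Proof.
have h := mlabel_pair momega (mlabel_pre mp mF).
exact: (h [set u : n.-tuple I * {set n.-tuple I} | u.1 \notin u.2]).
Qed.

(** A point is uncovered only if no cylinder of its fibre's family contains it; the family is chosen
    so that this has conditional probability at most [rho], and [transfer] integrates over the
    fibres. *)
Lemma uncovered_le : (P uncovered <= rho%:E)%E.
Proof.
pose Q (z : Z) (b : {ffun n.-tuple I -> bool}) := [forall w in F z, ~~ b w].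
pose g b z : \bar R := if Q z b then 1%E else 0%E.
have mg b : measurable_fun setT (g b).
  exact: (measurable_of_label (fun G : {set n.-tuple I} =>
    if [forall w in G, ~~ b w] then 1%E else 0%E : \bar R) mF).
have g0 b z : (0 <= g b z)%E by rewrite /g; case: ifP.
have tr := transfer condP mbits mg g0.
apply: (@le_trans _ _ (\int[P]_x g (bits x) (p x))%E).
  have mU := measurable_uncovered.
  rewrite -[X in (P X <= _)%E]setIT -integral_indic//.
  apply: ge0_le_integral => //.
  - by apply/measurable_EFinP; exact: measurable_indic.
  - exact: (measurable_label mp mbits mg).
  move=> x _; rewrite indicE; case: (boolP (x \in uncovered)) => // xU.
  rewrite inE in xU; rewrite /g ifT//; apply/forall_inP => w wF; apply/negP => bw.
  move: xU; rewrite /uncovered/= /itinerary /preferred_word.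
  case: pickP => [w' /andP[->//]|/(_ w)].
  by rewrite wF bw.
rewrite tr; apply: (@le_trans _ _ (\int[P]_x (cst rho%:E x))%E); last first.
  by rewrite integral_cst//= probability_setT mule1.
apply: ge0_le_integral => //.
- by move=> x _; apply: sume_ge0 => b _; rewrite mule_ge0.
- apply: emeasurable_sum => b; apply: emeasurable_funM.
    exact: (measurableT_comp (mg b) mp).
  exact: (measurableT_comp (mk (@mbits [set b])) mp).
move=> x _; set z := p x.
have -> : (\sum_b g b z * kappa z (bits @^-1` [set b]) = kappa z [set y | Q z (bits y)])%E.
  rewrite -(sum_cprob_pred kappa mbits (Q z)) -sumEFin [RHS]big_mkcond/=.
  apply: eq_bigr => b _; rewrite (cprobE _ mbits) /g.
  by case: ifP; rewrite ?mul1e ?mul0e.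
have mc : measurable (covered cyl (F z)) by exact: measurable_covered.
apply: (@le_trans _ _ (kappa z (~` covered cyl (F z)))).
  apply: le_measure; rewrite ?inE//; first exact: (mbits [set b | Q z b]).
    exact: measurableC.
  move=> y /= /forall_inP h [w /= wF cw].
  by have := h w wF; rewrite ffunE => /negP; apply; apply/asboolP.
have [en _] := min_familyP covcyl rho01 (kappa z).
rewrite probability_setC//; move: en; rewrite /enough -/(fibre_family z) -/(F z).
rewrite -[kappa z (covered _ _)]fineK ?fin_num_measure//.
by rewrite -EFinB !lee_fin; lra.
Qed.

(** The bound of [prefix_weight_mem] on covered points, enlarged on the others to dominate that of
    [prefix_weight_all]. *)
Let fibre_cost v : R := ln 2 + ln #|F (p v)|%:R + n%:R * ln K * \1_uncovered v.

Let lnF_ge0 v : 0 <= ln #|F (p v)|%:R :> R.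
Proof. by rewrite ln_ge0// ler1n. Qed.

Let ln2_ge0 : 0 <= ln 2 :> R.
Proof. by rewrite ln_ge0// ler1n. Qed.

Let fibre_cost_ge0 v : 0 <= fibre_cost v.
Proof. by rewrite !addr_ge0// !mulr_ge0. Qed.

Let mlnF : measurable_fun setT (fun v => ln #|F (p v)|%:R : R).
Proof.
exact: (measurable_of_label (fun G : {set n.-tuple I} => ln #|G|%:R : R) (mlabel_pre mp mF)).
Qed.

Let mind : measurable_fun setT (\1_uncovered : X -> R).
Proof. exact: measurable_indic measurable_uncovered. Qed.

Let mfibre_cost : measurable_fun setT fibre_cost.
Proof.
apply: measurable_funD; last exact: measurable_funM.
exact: measurable_funD.
Qed.

Let itinerary_cost v : - ln (prefix_weight (F (p v)) (omega v)) <= fibre_cost v.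
Proof.
have I_gt0 : (0 < #|I|)%N by apply/card_gt0P; exists i0.
rewrite /fibre_cost indicE; case: (boolP (v \in uncovered)) => vU.
  apply: (le_trans (prefix_weight_all I_gt0 _ _)); rewrite size_tuple mulr1.
  by rewrite -addrA lerD2l lerDr.
rewrite mulr0 addr0; apply: prefix_weight_mem => //.
by apply: contraNT vU => h; rewrite inE.
Qed.

Lemma integral_fibre_cost : (\int[P]_v (fibre_cost v)%:E <=
  (ln 2)%:E + \int[P]_x (ln (cyl_ncov T V rho n (kappa (p x)))%:R)%:E
    + (n%:R * ln K * rho)%:E)%E.
Proof.
have c0 : 0 <= n%:R * ln K by rewrite mulr_ge0.
under eq_integral do rewrite /fibre_cost !EFinD EFinM.
have m1 : measurable_fun setT (fun v => (ln #|F (p v)|%:R)%:E : \bar R) by exact/measurable_EFinP.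
have m2 : measurable_fun setT (fun v => (\1_uncovered v)%:E : \bar R) by exact/measurable_EFinP.
rewrite ge0_integralD//; last 4 first.
- by move=> x _; rewrite adde_ge0// lee_fin.
- by apply: emeasurable_funD.
- by move=> x _; rewrite mule_ge0// lee_fin.
- by apply: emeasurable_funM.
rewrite ge0_integralD//; last by move=> x _; rewrite lee_fin.
rewrite integral_cst//= probability_setT mule1.
apply: leeD => //; rewrite ge0_integralZl//.
rewrite integral_indic ?setIT//; last exact: measurable_uncovered.
by rewrite [leRHS]EFinM lee_wpmul2l ?lee_fin// uncovered_le.
Qed.

Let fibre_cost_fin : (\int[P]_v (fibre_cost v)%:E)%E \is a fin_num.
Proof.
have /choice[f hf] := covV.
rewrite ge0_fin_numE; last by apply: integral_ge0 => x _; rewrite lee_fin.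
apply: (le_lt_trans integral_fibre_cost).
have h : (\int[P]_x (ln (cyl_ncov T V rho n (kappa (p x)))%:R)%:E <= (n%:R * ln K)%:E)%E.
  apply: (@le_trans _ _ (\int[P]_x cst (n%:R * ln K)%:E x)%E); last first.
    by rewrite integral_cst//= probability_setT mule1.
  apply: ge0_le_integral => //.
  - move=> x _; rewrite lee_fin.
    exact: (ln_cyl_ncov_ge0 T (W := f) (g := id) hf rho01).
  - exact: (measurable_cyl_ncov setting mV).
  - move=> x _; rewrite lee_fin.
    exact: (ln_cyl_ncov_le T (W := f) (g := id) hf rho01).
apply: (@le_lt_trans _ _ ((ln 2)%:E + (n%:R * ln K)%:E + (n%:R * ln K * rho)%:E)%E).
  by rewrite leeD2r// leeD2l.
by rewrite -!EFinD ltry.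
Qed.

Variable eta : R.
Hypothesis eta_gt0 : 0 < eta.

(** Each point starts a block for exactly one of the [n] phases, so the costs of the phases add up
    to [fibre_cost], and the cheapest phase pays at most the average. *)
Lemma exists_phase (r : X -> nat) : mlabel r -> exists j : nat,
  let phi x := Ordinal (ltn_pmod (r x + j) n_gt0) in
  (n%:R%:E * \int[P]_v (block_cost p phi F omega v)%:E <= \int[P]_v (fibre_cost v)%:E)%E.
Proof.
move=> mr.
pose phi (j : nat) x : 'I_n := Ordinal (ltn_pmod (r x + j) n_gt0).
have mphi j : mlabel (phi j).
  exact: (mlabel_comp (fun k => Ordinal (ltn_pmod (k + j) n_gt0)) mr).
pose b (j : nat) v : R := if phi j v == 0%N :> nat then fibre_cost v else 0.
have b0 j v : 0 <= b j v by rewrite /b; case: ifP.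
have mb j : measurable_fun setT (b j).
  have -> : b j = fun v => fibre_cost v * \1_(phi j @^-1` [set k | k == 0%N :> nat]) v.
    apply/funext => v; rewrite /b indicE; case: ifP => h.
      by rewrite mem_set ?mulr1.
    by rewrite memNset ?mulr0//= h.
  by apply: measurable_funM => //; apply: measurable_indic; exact: mphi.
have bsum v : \sum_(j < n) b j v = fibre_cost v.
  (* The only phase that puts [v] at clock value 0 is the opposite of [r v] modulo [n]. *)
  have jn : ((n - r v %% n) %% n < n)%N by rewrite ltn_mod.
  have zero (j : 'I_n) : ((r v + j) %% n == 0)%N = (j == Ordinal jn).
    rewrite -(inj_eq val_inj)/=; have rn : (r v %% n < n)%N by rewrite ltn_mod.
    rewrite -modnDml; have := ltn_ord j; move: (nat_of_ord j) (r v %% n)%N rn => k q qn kn.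
    have [->|q0] := eqVneq q 0%N; first by rewrite add0n subn0 modnn modn_small.
    rewrite [in RHS]modn_small; last by lia.
    have [h|h] := leqP n (q + k).
      have -> : ((q + k) %% n = q + k - n)%N.
        by rewrite -{1}(subnK h) modnDr modn_small//; lia.
      by apply/eqP/eqP; lia.
    by rewrite modn_small//; apply/eqP/eqP; lia.
  rewrite (bigD1 (Ordinal jn))//= big1 ?addr0.
    by rewrite /b /= (zero (Ordinal jn)) eqxx.
  by move=> j jj; rewrite /b /= zero (negbTE jj).
have bfin j : (\int[P]_v (b j v)%:E)%E \is a fin_num.
  rewrite ge0_fin_numE; last by apply: integral_ge0 => x _; rewrite lee_fin.
  apply: (@le_lt_trans _ _ (\int[P]_v (fibre_cost v)%:E)%E).
    apply: ge0_le_integral => //.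
    - by move=> x _; rewrite lee_fin.
    - exact/measurable_EFinP.
    - exact/measurable_EFinP.
    - by move=> x _; rewrite lee_fin /b; case: ifP.
  by rewrite ltey_eq fibre_cost_fin.
pose B j := fine (\int[P]_v (b j v)%:E)%E.
have BE j : (\int[P]_v (b j v)%:E)%E = (B j)%:E by rewrite fineK.
have total : (\int[P]_v (fibre_cost v)%:E)%E = (\sum_(j < n) B j)%:E.
  rewrite -sumEFin; under eq_bigr do rewrite -BE.
  rewrite -ge0_integral_sum//.
  - by apply: eq_integral => v _; rewrite sumEFin bsum.
  - by move=> j; exact/measurable_EFinP.
  - by move=> j x _; rewrite lee_fin.
have [j _ jmin] := @Order.TotalTheory.arg_minP _ R _ (Ordinal n_gt0) xpredT (fun j => B j) isT.
exists j => /=; rewrite total.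
apply: (@le_trans _ _ (n%:R%:E * (B j)%:E)%E).
  apply: lee_wpmul2l; first by rewrite lee_fin.
  rewrite -BE; apply: ge0_le_integral => //.
  - by move=> x _; rewrite lee_fin block_cost_ge0//; apply/card_gt0P; exists i0.
  - by apply/measurable_EFinP; exact: (measurable_block_cost setting (mphi j) mF momega).
  - exact/measurable_EFinP.
  - move=> x _; rewrite lee_fin /block_cost /b -/(phi j) /=.
    by case: ifP => // _; exact: itinerary_cost.
rewrite -EFinM lee_fin mulr_natl -[leLHS]/(B j *+ n).
rewrite -[X in _ *+ X](card_ord n) -sumr_const; apply: ler_sum => k _; exact: jmin.
Qed.

Lemma exists_subordinate_label : exists a : X -> I,
  mlabel a /\ forall x, V (a x) x.
Proof.
pose bit x : {ffun I -> bool} := [ffun i => `[< V i x >]].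
have mbit : mlabel bit by apply: mlabel_ffun => w; exact: mlabel_bool.
exists (fun x => odflt i0 [pick i | bit x i]); split.
  exact: (mlabel_comp (fun b : {ffun I -> bool} => odflt i0 [pick i | b i]) mbit).
move=> x; case: pickP => [i|h] /=; first by rewrite ffunE => /asboolP.
by have [i hi] := covV x; have := h i; rewrite ffunE => /asboolP.
Qed.

Lemma katok_lower_bound : exists a : X -> I, [/\ mlabel a, forall x, V (a x) x &
  ((entropy_rate P p kappa T a)%:E <=
    (n%:R^-1)%:E * \int[P]_x (ln (cyl_ncov T V rho n (kappa (p x)))%:R)%:E
      + (ln 2 / n%:R + rho * ln K + eta)%:E)%E].
Proof.
have n0 : 0 < n%:R :> R by rewrite ltr0n.
have /choice[f hf] := covV.
have I0 : (0 <= \int[P]_x (ln (cyl_ncov T V rho n (kappa (p x)))%:R)%:E)%E.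
  apply: integral_ge0 => x _; rewrite lee_fin.
  exact: (ln_cyl_ncov_ge0 T (W := f) (g := id) hf rho01).
have rho0 : 0 < rho by case/andP: rho01.
have C0' : 0 <= ln 2 / n%:R + rho * ln K + eta.
  by rewrite !addr_ge0 ?divr_ge0 ?mulr_ge0// ltW.
(* If positive measures are bounded below, no marker set can be made small; the rate is then 0 for
   every label, and any label subordinate to the cover will do. *)
have [[a [a0 gap]]|nogap] := pselect (exists a : R, 0 < a /\
    forall A, measurable A -> P A = 0%E \/ (a%:E <= P A)%E).
  have [b [mb Vb]] := exists_subordinate_label.
  exists b; split => //; rewrite (entropy_rate_atomic setting mb a0 gap).
  by rewrite adde_ge0// mule_ge0// lee_fin invr_ge0 ltW.
(* The error [eta] is halved: this [e] makes the clock transitions cost [eta / 2], and the defects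
   may cost as much again. *)
pose e := 1 - expR (- (eta / 2)).
have e01 : 0 < e < 1.
  by rewrite subr_gt0 expR_lt1 oppr_lt0 divr_gt0//= gtrBl expR_gt0.
have lne : - ln (1 - e) = eta / 2.
  by rewrite /e opprB addrC subrK expRK opprK.
pose C := - ln (clock_floor I n e).
have pc := predictor_clock setting i0 n_gt0 mF e01.
have C0 : 0 <= C.
  pose phi0 (x : X) : 'I_n := Ordinal n_gt0.
  exact: le_trans (pcost_ge0 p T (fun x => (f x, phi0 x)) pc point)
    (pcost_le p T (fun x => (f x, phi0 x)) pc point).
have D0 : 0 < C * n%:R + 1 by rewrite ltr_wpDl// mulr_ge0.
(* The defects cost at most [C * n%:R] times the measure of [A]; the added 1 keeps the denominator
   positive. *)
have [A [mA PA0 PA]] : exists A, [/\ measurable A, (0 < P A)%E &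
    (P A < (eta / 2 / (C * n%:R + 1))%:E)%E].
  apply: contrapT => h; apply: nogap; exists (eta / 2 / (C * n%:R + 1)); split.
    by rewrite !divr_gt0.
  move=> A mA; have [->|PA0] := eqVneq (P A) 0%E; [by left|right].
  rewrite leNgt; apply/negP => PA; apply: h; exists A; split => //.
  by rewrite lt0e PA0 measure_ge0.
pose r := marker_height S A.
have mr : mlabel r := mlabel_marker_height mS mA.
have [j hj] := exists_phase mr.
set phi := (fun x => Ordinal _) in hj; rewrite /= in hj.
have mphi : mlabel phi.
  exact: (mlabel_comp (fun k => Ordinal (ltn_pmod (k + j) n_gt0)) mr).
have rate := entropy_rate_clock_code setting mS TK i0 n_gt0 mphi mF momega F_gt0 e01.
exists (code_letter S i0 phi omega); split.
- exact: mlabel_code_letter.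
(* Going back and forth by the same number of steps returns to [x], so the inclusion holds at every
   point, defects included. *)
- move=> x; rewrite /code_letter.
  have := itinerary_cylinder (iter (phi x) S x) (phi x).
  by rewrite iterVK// (tnth_nth i0).
apply: (@le_trans _ _ (entropy_rate P p kappa T (clock_code S i0 phi omega))%:E).
  rewrite lee_fin.
  have mc : mlabel (clock_code S i0 phi omega) by exact: mlabel_clock_code.
  have := entropy_rate_comp setting (fun u : I * 'I_n => u.1) mc.
  exact.
apply: (le_trans rate); rewrite lne -/C.
(* When the marker height grows by one, the clock advances by one modulo [n]. *)
have defect : (P (clock_defect T phi) <= P A)%E.
  apply: le_trans (marker_defect_le mpT ergT mS TK mA PA0).
  apply: le_measure; rewrite ?inE.
  - exact: (measurable_clock_defect setting mphi).
  - exact: (measurable_marker_defect mpT mS mA).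
  move=> x; rewrite /clock_defect /marker_defect/=; apply: contraNneq => h.
  by rewrite /r h addSn -[((_ + _) %% n).+1]addn1 modnDml addn1.
have h1 : (C%:E * (n%:R%:E * P (clock_defect T phi)) <= (eta / 2)%:E)%E.
  apply: (@le_trans _ _ (C%:E * (n%:R%:E * (eta / 2 / (C * n%:R + 1))%:E))%E).
    by rewrite !lee_wpmul2l ?lee_fin// (le_trans defect)// ltW.
  rewrite -!EFinM lee_fin mulrA mulrCA ler_piMr// ?divr_ge0 ?(ltW eta_gt0)//.
  by rewrite ler_pdivrMr// mul1r lerDl.
have h2 : (\int[P]_v (block_cost p phi F omega v)%:E <=
    (n%:R^-1)%:E * \int[P]_x (ln (cyl_ncov T V rho n (kappa (p x)))%:R)%:E +
    (ln 2 / n%:R + rho * ln K)%:E)%E.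
  rewrite -(@lee_pmul2l _ n%:R%:E)//.
  apply: (le_trans hj); apply: (le_trans integral_fibre_cost).
  rewrite ge0_muleDr; [|by rewrite mule_ge0// lee_fin invr_ge0 ltW|].
    rewrite muleA -[X in (X * _ + _)%E]EFinM divff ?gt_eqF// mul1e -EFinM.
    rewrite [((ln 2)%:E + _)%E]addeC -addeA leeD2l// -EFinD lee_fin.
    rewrite mulrDr [X in _ <= X + _]mulrC divfK ?gt_eqF// lerD2l.
    by rewrite -mulrA [rho * _]mulrC.
  by rewrite lee_fin addr_ge0 ?divr_ge0 ?mulr_ge0// ltW.
apply: (le_trans (leeD (leeD2l _ h1) h2)).
by rewrite -EFinD -splitr addeC -addeA leeD2l// -EFinD lee_fin.
Qed.

End KatokLower.

(** * Topological factor maps *)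

Section CoverIter.
Context {X : ptopologicalType} (T : X -> X) (U : set (set X)).
Variables (I : Type) (i0 : I) (V : I -> set X).
Hypothesis UE : forall A, U A <-> exists i, A = V i.

(** The offset [k] is there for the induction: peeling off the first factor shifts the exponents of
    all the others. *)
Lemma cover_iter_shift k n A :
  (\big[@cover_join X/[set [set: X]]]_(i < n) cover_preimage (iter (k + i) T) U) A <->
  exists f : nat -> I, A = [set x | forall i, (i < n)%N -> V (f i) (iter (k + i) T x)].
Proof.
elim: n k A => [|n IH] k A.
  rewrite big_ord0 /=; split=> [->|[f ->]]; last by apply/seteqP; split.
  by exists (fun=> i0); apply/seteqP; split.
rewrite big_ord_recl; split.
  move=> [B [C [[B' /UE[i ->] <-] hC ->]]].
  have {hC} : (\big[@cover_join X/[set [set: X]]]_(i < n) cover_preimage (iter (k.+1 + i) T) U) C.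
    by move: hC; under eq_bigr do rewrite lift0 addnS -addSn.
  move=> /IH[f ->]; exists (fun j => if j is j'.+1 then f j' else i).
  apply/seteqP; split => x /=; rewrite addn0.
    by move=> [h0 h] [|j] jn; rewrite ?addn0// addnS -addSn; exact: h.
  move=> h; split; first by have := h 0%N isT; rewrite addn0.
  by move=> j jn; have := h j.+1 jn; rewrite addnS -addSn.
move=> [f ->].
exists (iter k T @^-1` V (f 0%N)),
  [set x | forall i, (i < n)%N -> V (f i.+1) (iter (k.+1 + i) T x)].
split.
- by exists (V (f 0%N)); [apply/UE; exists (f 0%N)|rewrite addn0].
- have : (\big[@cover_join X/[set [set: X]]]_(i < n) cover_preimage (iter (k.+1 + i) T) U)
    [set x | forall i, (i < n)%N -> V (f i.+1) (iter (k.+1 + i) T x)].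
    by apply/IH; exists (fun i => f i.+1).
  by under eq_bigr do rewrite addSn -addnS -lift0.
apply/seteqP; split => x /=.
  move=> h; split; first by have := h 0%N isT; rewrite addn0.
  by move=> j jn; have := h j.+1 jn; rewrite addnS -addSn.
by move=> [h0 h] [|j] jn; rewrite ?addn0// addnS -addSn; exact: h.
Qed.

Lemma cover_iterP n A : cover_iter T U n A <->
  exists w : n.-tuple I, A = cylinder T V w.
Proof.
split.
  move=> /(cover_iter_shift 0)[f ->]; exists [tuple f i | i < n].
  apply/seteqP; split => x h i; first by rewrite tnth_mktuple; exact: h.
  by move=> ni; have := h (Ordinal ni); rewrite tnth_mktuple.
move=> [w ->]; apply/(cover_iter_shift 0); exists (nth i0 w).
apply/seteqP; split => x h i; first by move=> ni; have := h (Ordinal ni); rewrite (tnth_nth i0).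
by rewrite (tnth_nth i0); apply: h.
Qed.

End CoverIter.

Section CoveringNumber.
Context {R : realType} {X : ptopologicalType} (T : X -> X) (U : set (set X)).
Variables (I : finType) (i0 : I) (V : I -> set X).
Hypothesis UE : forall A, U A <-> exists i, A = V i.
Let iterP n A := cover_iterP T i0 UE n A.
Hypothesis mT : measurable_fun [set: borel X] (T : borel X -> borel X).
Hypothesis mV : forall i, measurable (V i : set (borel X)).
Hypothesis covV : forall x, exists i, V i x.

(** Families of sets and families of words are compared in both directions, since distinct words may
    give the same cylinder. The measurable subset [A] in [covering_number] can be replaced by the
    union of the family, which is measurable here. *)
Lemma covering_numberE (m : probability (borel X) R) n (rho : R) : 0 < rho < 1 ->
  covering_number m (cover_iter T U n) rho =
  (cyl_ncov (X := borel X) T V rho n m)%:R.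
Proof.
move=> rho01.
pose cyl (w : n.-tuple I) : set (borel X) := cylinder T V w.
have mcyl w : measurable (cyl w) by exact: (measurable_cylinder w mT mV).
have covcyl x : exists w, cyl w x by exact: cylinder_cover.
have [eG minG] := min_familyP covcyl rho01 m.
apply/eqP; rewrite eq_le; apply/andP; split.
  set G := min_family cyl m rho in eG.
  pose Fs := seq_fset tt [seq cyl w | w <- enum G].
  apply: (@le_trans _ _ (#|` Fs|%fset%:R)); last first.
    rewrite ler_nat size_seq_fset (leq_trans (size_undup _))// size_map -cardE.
    exact: leqnn.
  apply: ge_inf; first by exists 0 => _ [F _ <-].
  exists Fs => //; split.
    move=> B; rewrite /= seq_fsetE => /mapP[w _ ->].
    by apply/iterP; exists w.
  exists (covered cyl G); split; [exact: measurable_covered|exact: eG|].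
  move=> x [w /= wG cx]; exists (cyl w) => //=.
  by rewrite seq_fsetE; apply/mapP; exists w => //; rewrite mem_enum.
apply: lb_le_inf.
  pose Fs := seq_fset tt [seq cyl w | w <- enum (@predT (n.-tuple I))].
  exists (#|` Fs|%fset%:R), Fs => //; split.
    move=> B; rewrite /= seq_fsetE => /mapP[w _ ->].
    by apply/iterP; exists w.
  exists setT; split => //.
    by rewrite probability_setT lee_fin gerBl; case/andP: rho01 => /ltW.
  move=> x _; have [w cw] := covcyl x; exists (cyl w) => //=.
  by rewrite seq_fsetE; apply/mapP; exists w => //; rewrite mem_enum.
move=> _ [Fs [FU [A [mA PA AF]]] <-]; rewrite ler_nat.
have /choice[h hh] : forall B, exists w : n.-tuple I, cover_iter T U n B -> B = cyl w.
  move=> B; have [/iterP[w ->]|nB] := pselect (cover_iter T U n B).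
    by exists w.
  by exists [tuple i0 | _ < n].
pose G' : {set n.-tuple I} := [set w | w \in map h (enum_fset Fs)]%SET.
apply: (@leq_trans #|G'|); last first.
  rewrite cardsE (leq_trans (card_size _))// size_map; exact: leqnn.
apply: minG; rewrite /enough; apply: (le_trans PA).
apply: le_measure; rewrite ?inE//; first exact: measurable_covered.
move=> x /AF[B /= BF Bx]; exists (h B).
  by rewrite /= inE; apply/mapP; exists B.
by rewrite -(hh B)//; exact: FU.
Qed.

End CoveringNumber.

Section PartitionLabels.
Context {R : realType} {X : ptopologicalType} {dZ : measure_display}
  {Z : measurableType dZ}.
Variables (mu : probability (borel X) R) (p : borel X -> Z)
  (kappa : Z -> probability (borel X) R) (T : borel X -> borel X) (T' : Z -> Z).
Hypothesis setting : factor_setting mu p kappa T T'.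
Variables (alpha : set (set X)) (L : finType) (W : borel X -> L).
Hypothesis mW : mlabel W.
Hypothesis blockP : forall A x, alpha A -> A x -> A = W @^-1` [set W x].
Hypothesis blockT : forall x, alpha (W @^-1` [set W x]).

(** [pblock] picks some element of the iterated cover containing [x]; every factor of such an
    element is the block of the corresponding iterate, so the pick is forced. *)
Lemma pblock_cover_iter n x :
  pblock (cover_iter T alpha n) id x = word T W n @^-1` [set word T W n x].
Proof.
pose V (A : {A : set X | alpha A}) := sval A.
have VE A : alpha A <-> exists i, A = V i.
  split=> [aA|[[B aB] ->]//]; by exists (exist _ A aA).
pose b y : {A : set X | alpha A} := exist _ _ (blockT y).
have itP := cover_iter_shift T (b x) VE 0 n.
have ex : exists A, cover_iter T alpha n A /\ A x.
  exists [set y | forall i, (i < n)%N -> V (b (iter i T x)) (iter (0 + i) T y)].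
  by split; [apply/itP; exists (fun i => b (iter i T x))|].
have [/itP[f fE] fx] := getPex ex.
rewrite fE in fx.
have -> : pblock (cover_iter T alpha n) id x =
  get [set A | cover_iter T alpha n A /\ A x] by [].
rewrite fE.
apply/seteqP; split => y /=.
  move=> h; apply: eq_from_tnth => i; rewrite !(tnth_nth (W x))/= !nth_mkseq//.
  have := h i (ltn_ord i).
  by rewrite add0n /V (blockP (svalP (f i)) (fx i (ltn_ord i))).
move=> e i ni; rewrite /V (blockP (svalP (f i)) (fx i ni))/= add0n.
have := congr1 (fun w => tnth w (Ordinal ni)) e.
by rewrite !(tnth_nth (W x))/= !nth_mkseq.
Qed.

Lemma measurable_lne_cprob n w :
  measurable_fun setT (fun z => (- lne (kappa z (word T W n @^-1` [set w])))%E).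
Proof.
have [condP [mT _] _ _] := setting.
have mword : mlabel (word T W n) by exact: mlabel_word.
have mc := measurable_cprob condP mword w.
set c := cprob kappa (word T W n) w in mc.
(* At 0 the extended logarithm is infinite while [ln] is 0; the first summand restores the infinite
   value there. *)
rewrite (_ : (fun z => _) = fun z =>
  (+oo * (\1_(c @^-1` [set (0 : R)]) z)%:E + (- ln (c z))%:E)%E); last first.
  apply/funext => z; rewrite -(cprobE kappa mword) -/(c z) indicE.
  have [c0|c0] := eqVneq (c z) 0.
    by rewrite mem_set// c0 ln0// oppr0 adde0 mule1 le0_lneNy.
  rewrite memNset ?mule0 ?add0e; last by move=> /eqP; rewrite (negbTE c0).
  by rewrite lne_EFin// lt0r c0 cprob_ge0.
apply: emeasurable_funD.
  apply: measurable_funeM; apply/measurable_EFinP/measurable_indic.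
  by rewrite -[_ @^-1` _]setTI; exact: mc.
apply/measurable_EFinP; apply: measurable_funN.
by apply: measurableT_comp; first exact: measurable_ln.
Qed.

(** The two integrands differ at most where the observed word has conditional mass 0, and this is a
    null set. *)
Lemma partition_entropyE : partition_entropy T mu (fun x => kappa (p x)) alpha =
  (entropy_rate mu p kappa T W)%:E.
Proof.
have [condP [mT _] _ _] := setting.
have mword n : mlabel (word T W n) by exact: mlabel_word.
have [mp _ _] := condP.
rewrite /partition_entropy -(cvg_lim _ (cvg_entropy_rate setting mW))//.
congr (limn _); apply/funext => n; congr (_ * _)%E.
apply: ge0_ae_eq_integral => //.
- apply: eq_measurable_fun (measurable_label mp (@mword n) (measurable_lne_cprob (n := n))).
  by move=> x _; rewrite pblock_cover_iter.
- by apply/measurable_EFinP; exact: (measurable_information condP (@mword n)).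
- move=> x _; rewrite pblock_cover_iter oppe_ge0 lne_le0 probability_le1//.
  exact: mword.
- by move=> x _; rewrite lee_fin (information_ge0 p kappa (@mword n)).
apply: filterS (cprob_gt0_ae condP (@mword n)) => x c0 _.
by rewrite pblock_cover_iter -(cprobE kappa (@mword n)) lne_EFin.
Qed.

End PartitionLabels.

Lemma limn_esup_le {R : realType} (u : (\bar R)^nat) (c : \bar R) :
  (\forall n \near \oo, (u n <= c)%E) -> (limn_esup u <= c)%E.
Proof.
move=> [N _ hN]; apply: ge_ereal_inf.
exists (ereal_sup (u @` [set n | (N <= n)%N])).
  by exists [set n | (N <= n)%N] => //; exists N.
by apply: ge_ereal_sup => _ [n /= Nn <-]; exact: hN.
Qed.

Lemma limn_einf_ge {R : realType} (u : (\bar R)^nat) (c : \bar R) :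
  (\forall n \near \oo, (c <= u n)%E) -> (c <= limn_einf u)%E.
Proof.
move=> h; rewrite /limn_einf leeNr; apply: limn_esup_le.
by apply: filterS h => n cu; rewrite leeN2.
Qed.

Lemma continuous_borel (X Y : ptopologicalType) (f : X -> Y) : continuous f ->
  measurable_fun [set: borel X] (f : borel X -> borel Y).
Proof.
move=> /continuousP cf; apply: (@measurability _ _ (borel X) (borel Y) _ _ (@open Y)) => //.
move=> _ [B oB <-]; rewrite setTI; apply: sub_sigma_algebra; exact: cf.
Qed.

(** * Open covers of a topological factor map *)

Section FactorOfMetricSystems.
Context {R : realType} {X Y : pmetricType R}.
Variables (T : X -> X) (S : Y -> Y) (pi : X -> Y)
  (mu : probability (borel X) R) (mux : X -> probability (borel X) R).
Hypothesis tdsT : tds T.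
Hypothesis tdsS : tds S.
Hypothesis factor : factor_map T S pi.
Hypothesis ergT : ergodic T mu.
Hypothesis dis : disintegration pi mu mux.

Local Notation fibres := (g_sigma_algebra_preimageType (pi : X -> borel Y)).

Let mT : measurable_fun [set: borel X] (T : borel X -> borel X).
Proof. by apply: continuous_borel; case: tdsT => _ []. Qed.

Let mpi : measurable_fun [set: borel X] (pi : borel X -> borel Y).
Proof. by apply: continuous_borel; case: factor. Qed.

Let measurable_fibre (y : Y) : measurable (pi @^-1` [set y] : set (borel X)).
Proof.
rewrite -[_ @^-1` _]setTI; apply: mpi => //.
rewrite -[[set y]]setCK; apply: measurableC; apply: sub_sigma_algebra.
apply: closed_openC; apply: accessible_closed_set1.
exact: hausdorff_accessible (@metric_hausdorff _ _).
Qed.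

(* Since [mux x] is carried by the fibre of [x], intersecting with a union of
   fibres either does not change the conditional mass or kills it. *)
Lemma disintegration_conditional :
  conditional (X := borel X) (Z := fibres) mu id mux.
Proof.
have [mk ae1 muE] := dis; split.
- move=> _ B [C mC <-]; rewrite !setTI; rewrite -[_ @^-1` _]setTI.
  exact: mpi.
- by move=> A mA; exact: mk.
move=> A B mA [C mC]; rewrite setTI => <-; rewrite preimage_id.
have mB : measurable (pi @^-1` C : set (borel X)).
  by rewrite -[_ @^-1` _]setTI; exact: mpi.
have mk' D : measurable D -> measurable_fun [set: borel X] (fun x => mux x D).
  move=> mD _ E mE; have [C' mC' <-] := mk D mD measurableT E mE.
  by rewrite setTI -[_ @^-1` _]setTI; exact: mpi.
rewrite muE; last exact: measurableI.
rewrite [RHS]integral_mkcond; apply: ge0_ae_eq_integral => //.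
- by apply: mk'; exact: measurableI.
- apply/(measurable_restrictT _ _).1 => //; apply: measurable_funTS; exact: mk'.
- by move=> x _; apply: erestrict_ge0.
case: ae1 => N [mN N0 subN]; exists N; split => // x hx; apply: subN => x1.
apply: hx => _.
have x0 : mux x (~` (pi @^-1` [set pi x])) = 0%E.
  by rewrite probability_setC ?x1 ?subee//; exact: measurable_fibre.
rewrite /patch; case: ifPn => xC.
  rewrite inE /= in xC.
  apply/eqP; rewrite eq_le; apply/andP; split.
    by apply: le_measure; rewrite ?inE//; exact: measurableI.
  apply: (@le_trans _ _ (mux x ((A `&` pi @^-1` C) `|` ~` (pi @^-1` [set pi x])))).
    apply: le_measure; rewrite ?inE//.
      apply: measurableU; first exact: measurableI.
      by apply: measurableC; exact: measurable_fibre.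
    move=> y Ay; have [yx|yx] := pselect (pi y = pi x); last by right.
    by left; split => //=; rewrite yx.
  apply: le_trans (measureU2 _ _ _) _; first exact: measurableI.
    by apply: measurableC; exact: measurable_fibre.
  by rewrite [X in (_ + X)%E]x0 adde0.
rewrite notin_setE /= in xC.
apply: (subset_measure0 _ _ _ x0).
- exact: measurableI.
- by apply: measurableC; exact: measurable_fibre.
- by move=> y [_ /= Cy] /= yx; apply: xC; rewrite -yx.
Qed.

(* The base of the abstract setting is [X] itself with the sigma-algebra pulled back
   from [Y], so that the projection is the identity and [mux] is measurable on it. *)
Lemma factor_map_setting :
  factor_setting (X := borel X) (Z := fibres) mu id mux T T.
Proof.
split.
- exact: disintegration_conditional.
- by split => //; case: ergT.
- move=> _ B [C mC <-]; rewrite !setTI.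
  exists (S @^-1` C).
    rewrite -[_ @^-1` _]setTI; apply: (continuous_borel (f := S)) => //.
    by case: tdsS => _ [].
  rewrite setTI; have [_ _ TS] := factor.
  apply/seteqP; split => x /=.
    by have := congr1 (fun f => f x) TS => /= ->.
  by have := congr1 (fun f => f x) TS => /= ->.
- by [].
Qed.

Let setting := factor_map_setting.

Variable U : set (set X).
Hypothesis openU : open_cover U.

Let finU : finite_set U. Proof. by case: openU. Qed.
Let I : finType := fset_set U.
Let V (i : I) : set X := fsval i.

Let UE A : U A <-> exists i, A = V i.
Proof.
split=> [UA|[i ->]].
  have h : A \in fset_set U by rewrite in_fset_set// inE.
  by exists [` h]%fset.
by have := fsvalP i; rewrite in_fset_set// inE.
Qed.

Let mV i : measurable (V i : set (borel X)).
Proof.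
apply: sub_sigma_algebra; case: openU => _ + _; apply; apply/UE; by exists i.
Qed.

Let covV x : exists i, V i x.
Proof.
have [_ _ cU] := openU; have : cover U id x by rewrite cU.
by move=> [A /UE[i ->] Vx]; exists i.
Qed.

Let i0 : I := projT1 (cid (covV point)).
Let K : R := #|I|%:R.

Lemma average_log_coveringE n (rho : R) : 0 < rho < 1 ->
  average_log_covering T mu mux U rho n =
  ((n%:R^-1)%:E * \int[mu]_x (ln (cyl_ncov (X := borel X) T V rho n (mux x))%:R)%:E)%E.
Proof.
move=> rho01; congr (_ * _)%E; apply: eq_integral => x _.
by rewrite (covering_numberE i0 UE mT mV covV).
Qed.

(** The block containing a point is a label, and the refinement assigns to each block a member of
    [U], as [katok_upper_bound] requires. *)
Lemma esup_average_le (rho : R) alpha : 0 < rho < 1 ->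
  borel_partition alpha -> refines alpha U ->
  (limn_esup (average_log_covering T mu mux U rho) <= partition_entropy T mu mux alpha)%E.
Proof.
move=> rho01 [[fina ma cova] trivA] ref.
pose L : finType := fset_set alpha.
pose A (l : L) : set X := fsval l.
have aA l : alpha (A l) by have := fsvalP l; rewrite in_fset_set// inE.
have /choice[W hW] : forall x : X, exists l : L, A l x.
  move=> x; have : cover alpha id x by rewrite cova.
  move=> [B aB Bx]; have h : B \in fset_set alpha by rewrite in_fset_set// inE.
  by exists [` h]%fset.
have block_eq B C x : alpha B -> alpha C -> B x -> C x -> B = C.
  by move=> aB aC Bx Cx; apply: (trivA B C aB aC); exists x.
have blockP B x : alpha B -> B x -> B = W @^-1` [set W x].
  move=> aB Bx; apply/seteqP; split => y /=.
    move=> By; apply: val_inj; rewrite -[val _]/(A (W y)) -[val _]/(A (W x)).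
    by rewrite -(block_eq _ _ _ aB (aA _) By (hW y)) -(block_eq _ _ _ aB (aA _) Bx (hW x)).
  by move=> yx; have := hW y; rewrite yx -(block_eq _ _ _ aB (aA _) Bx (hW x)).
have AW x : A (W x) = W @^-1` [set W x] by exact: blockP.
have blockT x : alpha (W @^-1` [set W x]) by rewrite -AW.
have mW : mlabel (W : borel X -> L).
  apply: mlabel_countable => l.
  have [[x <-]|nx] := pselect (exists x, W x = l).
    by apply: ma; exact: blockT.
  rewrite (_ : _ @^-1` _ = set0)//; apply/seteqP; split => // x /= Wx.
  by apply: nx; exists x.
have -> := partition_entropyE setting mW blockP blockT.
have /choice[g hg] : forall l : L, exists i : I, A l `<=` V i.
  move=> l; have [B UB AB] := ref _ (aA l).
  by have /UE[i Bi] := UB; exists i; rewrite -Bi.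
apply/lee_addgt0Pr => e e0; apply: limn_esup_le.
have ub := katok_upper_bound setting (proj2 ergT) mW mV (fun x => hg _ _ (hW x)) rho01
  (r := entropy_rate (X := borel X) (Z := fibres) mu id mux T W + e).
have {}ub := ub (ltac:(by rewrite ltrDl)).
near=> n; rewrite average_log_coveringE//.
have n0 : 0 < n%:R :> R by rewrite ltr0n; near: n; exists 1%N.
rewrite -(@lee_pmul2l _ n%:R%:E)// muleA -[X in (X * _ <= _)%E]EFinM divff ?gt_eqF// mul1e.
by near: n; exact: ub.
Unshelve. all: by end_near. Qed.

Lemma cover_entropy_le_label (a : borel X -> I) : mlabel a -> (forall x, V (a x) x) ->
  (cover_entropy T mu mux U <=
    (entropy_rate (X := borel X) (Z := fibres) mu id mux T a)%:E)%E.
Proof.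
move=> ma Va; apply: ge_ereal_inf.
pose alpha : set (set X) := [set a @^-1` [set a x] | x in [set: X]].
have blockP B x : alpha B -> B x -> B = a @^-1` [set a x].
  by move=> [y _ <-] /= ->.
have blockT x : alpha (a @^-1` [set a x]) by exists x.
exists (partition_entropy T mu mux alpha); last first.
  by rewrite (partition_entropyE setting ma blockP blockT).
exists alpha => //; split; first split; first split.
- apply: (@sub_finite_set _ _ ((fun i => a @^-1` [set i]) @` [set: I])).
    by move=> _ [x _ <-]; exists (a x).
  exact: finite_image.
- by move=> _ [x _ <-]; exact: ma.
- by apply/seteqP; split => // x _; exists (a @^-1` [set a x]).
- by move=> B C aB aC [x [Bx Cx]]; rewrite /= (blockP _ _ aB Bx) (blockP _ _ aC Cx).
move=> _ [x _ <-]; exists (V (a x)); first by apply/UE; exists (a x).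
by move=> y /= <-; exact: Va.
Qed.

Lemma cover_entropy_le (rho eta : R) n : 0 < rho < 1 -> 0 < eta -> (0 < n)%N ->
  (cover_entropy T mu mux U <= average_log_covering T mu mux U rho n +
     (ln 2 / n%:R + rho * ln K + eta)%:E)%E.
Proof.
move=> rho01 eta0 n0.
have [_ [contT [T1 [contT1 TK T1K]]]] := tdsT.
have [a [ma Va ha]] := katok_lower_bound setting (proj2 ergT)
  (continuous_borel contT1) TK T1K mV covV rho01 n0 eta0.
rewrite average_log_coveringE//; apply: le_trans ha.
exact: cover_entropy_le_label.
Qed.

Lemma average_log_covering_ge0 (rho : R) n : 0 < rho < 1 ->
  (0 <= average_log_covering T mu mux U rho n)%E.
Proof.
move=> rho01; have /choice[f hf] := covV.
rewrite average_log_coveringE//; apply: mule_ge0; first by rewrite lee_fin invr_ge0.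
apply: integral_ge0 => x _; rewrite lee_fin.
exact: (ln_cyl_ncov_ge0 (X := borel X) T (W := f) (g := id) hf rho01).
Qed.

Lemma esup_average_le_cover (rho : R) : 0 < rho < 1 ->
  (limn_esup (average_log_covering T mu mux U rho) <= cover_entropy T mu mux U)%E.
Proof.
move=> rho01; apply: le_ereal_inf_tmp => _ [alpha [pa ra] <-].
exact: esup_average_le.
Qed.

(** Finiteness permits the subtractions in the lower bound. Nonnegativity is inherited from the
    covering averages, at the arbitrary value 1 / 2 of [rho]; one subordinate label gives the upper
    bound. *)
Lemma cover_entropy_fin : cover_entropy T mu mux U \is a fin_num.
Proof.
have h : 0 < (1 / 2 : R) < 1 by apply/andP; split; lra.
rewrite ge0_fin_numE.
  have [a [ma Va]] := exists_subordinate_label (X := borel X) mV covV.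
  exact: le_lt_trans (cover_entropy_le_label ma Va) (ltry _).
apply: le_trans (esup_average_le_cover h); apply: le_trans (limn_einf_sup _).
by apply: limn_einf_ge; apply: nearW => n; exact: average_log_covering_ge0.
Qed.

Lemma einf_average_ge (rho : R) : 0 < rho < 1 ->
  (cover_entropy T mu mux U - (rho * ln K)%:E <=
    limn_einf (average_log_covering T mu mux U rho))%E.
Proof.
move=> rho01; apply/lee_addgt0Pr => e e0.
rewrite -leeBlDr//; apply: limn_einf_ge.
have e20 : 0 < e / 2 by rewrite divr_gt0.
near=> n.
have n0 : (0 < n)%N by near: n; exists 1%N.
have ln2n : ln 2 / n%:R <= e / 2.
  rewrite ler_pdivrMr ?ltr0n// mulrC -ler_pdivrMr//; near: n.
  exists (Num.truncn (ln 2 / (e / 2) : R)).+1 => // m /= hm.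
  by apply: le_trans (ltW (truncnS_gt _)) _; rewrite ler_nat.
have := cover_entropy_le rho01 e20 n0.
rewrite -(fineK cover_entropy_fin) => h.
rewrite -!EFinB.
have : ((fine (cover_entropy T mu mux U) - (ln 2 / n%:R + rho * ln K + e / 2))%:E <=
    average_log_covering T mu mux U rho n)%E by rewrite EFinB leeBlDr.
apply: le_trans; rewrite lee_fin; lra.
Unshelve. all: by end_near. Qed.

(** Stated for any function between the lower and the upper limits, so that one squeeze yields both
    Katok entropies and the existence of the limit in [rho]. *)
Lemma cvg_average (u : R -> \bar R) :
  (forall rho, 0 < rho < 1 ->
    (limn_einf (average_log_covering T mu mux U rho) <= u rho <=
     limn_esup (average_log_covering T mu mux U rho))%E) ->
  u rho @[rho --> (0 : R)^'+] --> cover_entropy T mu mux U.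
Proof.
move=> hu; set h := cover_entropy T mu mux U.
have hE : h = (fine h)%:E by rewrite fineK// cover_entropy_fin.
apply: (@squeeze_cvge _ _ _ _ (fun rho => (fine h - rho * ln K)%:E) _ (cst h)).
- near=> rho.
  have rho01 : 0 < rho < 1.
    by apply/andP; split; near: rho; [exact: nbhs_right_gt|exact: nbhs_right_lt].
  have /andP[h1 h2] := hu _ rho01; apply/andP; split.
    by apply: le_trans h1; rewrite EFinB -hE; exact: einf_average_ge.
  exact: le_trans h2 (esup_average_le_cover rho01).
- rewrite hE; apply: cvg_EFin; first by near=> rho.
  apply: cvg_at_right_filter => /=.
  rewrite -[X in _ --> X]subr0 -[X in _ - X](mul0r (ln K)).
  apply: cvgB; first exact: cvg_cst.
  by apply: cvgMl; exact: cvg_id.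
- exact: cvg_cst.
Unshelve. all: by end_near. Qed.

End FactorOfMetricSystems.

Theorem proposition3p5 (R : realType) (X Y : pmetricType R)
    (T : X -> X) (S : Y -> Y) (pi : X -> Y)
    (mu : probability (borel X) R) (mux : X -> probability (borel X) R)
    (U : set (set X)) :
  tds T -> tds S -> factor_map T S pi ->
  ergodic T mu -> disintegration pi mu mux ->
  open_cover U ->
  upper_katok_entropy T mu mux U = lower_katok_entropy T mu mux U /\
  lower_katok_entropy T mu mux U = cover_entropy T mu mux U.
Proof.
move=> tdsT tdsS factor ergT dis openU.
have cvgU := cvg_average tdsT tdsS factor ergT dis openU.
have upperE : upper_katok_entropy T mu mux U = cover_entropy T mu mux U.
  apply: cvg_lim => //; apply: cvgU => rho _.
  by rewrite lexx andbT limn_einf_sup.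
have lowerE : lower_katok_entropy T mu mux U = cover_entropy T mu mux U.
  apply: cvg_lim => //; apply: cvgU => rho _.
  by rewrite lexx limn_einf_sup.
by rewrite upperE lowerE.
Qed.
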